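(* Let $f$ be a discrete Morse function on a finite simplicial complex $K$. Then the second barycentric subdivision $\mathrm{sd}^2(K)$ of $K$ carries Morse shellings whose critical tiles are in one-to-one correspondence with the critical faces of $f$, in such a way that the index is preserved (a critical tile of index $k$ corresponds to a critical face of $f$ of index $k$).
   Context: Simplices and complexes. An $n$-simplex is a set of $n+1$ vertices; its faces are all its subsets, including the empty set (of dimension $-1$). A finite simplicial complex $K$ is a collection of subsets of a finite vertex set containing all singletons and closed under taking subsets (so it contains $\emptyset$). Facets are maximal simplices; a ridge of a simplex is a codimension one face. A relative simplex is a simplex deprived of several proper faces (together with all the faces of those). A relative simplicial complex is $S=K\setminus L$, with $L$ a (possibly empty) subcomplex of $K$ containing no facet of $K$; $|S|=|K|\setminus|L|$. A relative subcomplex of $S$ is $K'\setminus L$ with $K'$ a subcomplex of $K$. $\mathrm{sd}$ denotes first barycentric subdivision (simplices are chains of nonempty simplices, for inclusion), and $\mathrm{sd}^2(K)=\mathrm{sd}(\mathrm{sd}(K))$. Tiles. A basic tile of dimension $n$ and order $k\in\{0,\dots,n+1\}$ is an $n$-simplex deprived of $k$ ridges. A Morse tile of dimension $n$ and order $k$ is an $n$-simplex deprived of $k$ ridges and possibly also of a unique face of codimension at least $2$ (its Morse face; the empty face is allowed). For a basic tile $T$ of order $k$, the restriction set $r(T)$ is the face, of dimension $k-1$, whose vertices are those opposite to the $k$ missing ridges. The critical tiles of dimension $n$ are: the closed simplex (index $0$), and the tiles $T\setminus r(T)$, for $T$ a basic tile of dimension $n$ and order $k\in\{0,\dots,n\}$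 (index $k$). For $k=0$ the latter is the closed simplex deprived of its empty face, and for $k=n$ it is the open simplex (only the top face). Morse tiles which are not critical are called regular. Shellings. A relative facet of $S=K\setminus L$ is a relative simplex of the form $\sigma\setminus\tau$, where $\sigma$ is a facet of $K$ and $\tau$ is a subcomplex of $\sigma$ containing $\sigma\cap L$. A tiling of $S$ is a partition of its geometric realization by relative facets. A shelling of the tiling is a filtration $\emptyset=S_0\subset S_1\subset\dots\subset S_N=S$ by relative subcomplexes such that for every $p\in\{1,\dots,N\}$, $S_p\setminus S_{p-1}$ consists of a single relative facet of the tiling. A Morse shelling is a shelling of a tiling all of whose relative facets are Morse tiles; its critical tiles are the tiles of the tiling which are critical. Discrete Morse functions. A discrete Morse function on $K$ is a function $f:K\setminus\{\emptyset\}\to\mathbb{R}$ such that for every nonempty $\sigma\in K$ the sets $\{\tau\in K : \sigma\subsetneq\tau,\ f(\sigma)\ge f(\tau)\}$ and $\{\theta\in K\setminus\{\emptyset\} : \theta\subsetneq\sigma,\ f(\sigma)\le f(\theta)\}$ have cardinality at most one. A nonempty simplex $\sigma$ is a critical face of $f$, of index $\dim\sigma$, if both of these sets are empty. *)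

(* Defs.v *)
From mathcomp Require Import all_boot all_order all_algebra.
From mathcomp Require Import reals.
From mathcomp Require classical_sets functions.

Set Implicit Arguments.
Unset Strict Implicit.
Unset Printing Implicit Defensive.

Import Order.TTheory GRing.Theory Num.Theory.
Local Open Scope set_scope.
Local Open Scope nat_scope.

(* Simplices on vertices of type T are finite sets (set0 being the empty face,
   of dimension -1), so s has dimension n iff #|s| = n.+1; complexes, relative
   complexes and tiles are all families of simplices. *)
Notation simplices T := {set {set T}}.

Section Complexes.
Variable T : finType.
Implicit Types (s m : {set T}) (V : {set T}) (K L S X : simplices T).

Definition face_closed K : Prop :=
  forall s t : {set T}, s \in K -> t \subset s -> t \in K.

(* A complex has at least one vertex, hence contains the empty face. *)
Definition simplicial_complex V K : Prop :=
  [/\ V != set0, K \subset powerset V,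
      (forall v, v \in V -> [set v] \in K) & face_closed K].

(* A subcomplex may be empty: set0 and [set set0] are both allowed. *)
Definition subcomplex L K : Prop := L \subset K /\ face_closed L.

Definition facet K s : Prop := maxset (mem K) s.

Definition sd K : simplices {set T} :=
  [set c : {set {set T}} | (c \subset K :\ set0) &&
    [forall s in c, forall t in c, (s \subset t) || (t \subset s)]].

Definition ridges s : simplices T :=
  [set r in powerset s | #|r|.+1 == #|s|].

Definition deprived s (M : {set {set T}}) : simplices T :=
  powerset s :\: \bigcup_(m in M) powerset m.

Definition basic_tile_of (n k : nat) s (M : {set {set T}}) : Prop :=
  [/\ #|s| = n.+1, M \subset ridges s & #|M| = k].

Definition morse_tile X : Prop :=
  exists n k s M, basic_tile_of n k s M /\
    (X = deprived s M \/
     exists m, [/\ m \subset s, #|m| + 2 <= #|s| & X = deprived s (m |: M)]).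

Definition restriction_set s (M : {set {set T}}) : {set T} :=
  [set v in s | s :\ v \in M].

Definition critical_tile (k : nat) X : Prop :=
  (k = 0 /\ exists s, s != set0 /\ X = powerset s) \/
  (exists n s M, [/\ basic_tile_of n k s M, k <= n &
     X = deprived s M :\: powerset (restriction_set s M)]).

(* In the following, the relative complex S is given by a pair (K, L),
   with S = K :\: L. *)

Definition relative_facet K L X : Prop :=
  exists s (t : simplices T),
    [/\ facet K s, subcomplex t (powerset s), s \notin t,
        powerset s :&: L \subset t & X = powerset s :\: t].

Definition relative_subcomplex K L S : Prop :=
  exists2 K' : simplices T, subcomplex K' K & S = K' :\: L.

(* Points are given by their barycentric coordinates; the support of a point is
   the simplex whose relative interior contains it. *)
Definition realization (R : realType) S :
    classical_sets.set {ffun T -> R} :=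
  fun x => [/\ forall v, (0 <= x v)%R, (\sum_v x v = 1)%R &
               [set v | x v != 0%R] \in S].

Arguments realization R S : clear implicits.

Definition tiling (R : realType) K L (P : {set simplices T}) : Prop :=
  (forall X, X \in P -> relative_facet K L X) /\
  classical_sets.partition (fun X => X \in P) (realization R)
    (realization R (K :\: L)).

Definition shelling K L (P : {set simplices T}) (N : nat)
    (F : nat -> simplices T) : Prop :=
  [/\ F 0 = set0, F N = K :\: L,
      (forall p, p <= N -> relative_subcomplex K L (F p)) &
      (forall p, p < N -> F p \subset F p.+1 /\ F p.+1 :\: F p \in P)].

Definition morse_shelling (R : realType) K L (P : {set simplices T}) (N : nat)
    (F : nat -> simplices T) : Prop :=
  [/\ tiling R K L P, (forall X, X \in P -> morse_tile X)
    & shelling K L P N F].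

Section DiscreteMorse.
Variables (R : realType) (K : simplices T) (f : {set T} -> R).

Definition exceptional_cofaces s : simplices T :=
  [set t in K | (s \proper t) && (f t <= f s)%R].

Definition exceptional_faces s : simplices T :=
  [set t in K :\ set0 | (t \proper s) && (f s <= f t)%R].

(* f stands for a function on K :\ set0: its other values are never used. *)
Definition discrete_morse : Prop :=
  forall s, s \in K :\ set0 ->
    #|exceptional_cofaces s| <= 1 /\ #|exceptional_faces s| <= 1.

Definition critical_face (k : nat) s : Prop :=
  [/\ s \in K, #|s| = k.+1,
      exceptional_cofaces s = set0 & exceptional_faces s = set0].

End DiscreteMorse.

End Complexes.

(* Main.v *)
Require Import Defs.
From mathcomp Require Import all_boot all_order all_algebra.
From mathcomp Require Import reals.
From mathcomp Require classical_sets functions.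

(* A discrete Morse function orders the nonempty simplices of [K], the two faces
   of a gradient pair having the same level and the upper one coming first. The
   second subdivision is built by adding, in this order, the closed stars of the
   vertices [[set y]], which are thickenings of the simplices [y]. Let [A] be the
   set of simplices added before [y]. The star of [[set y]] is a cone over the
   subdivision of the link of [y] in [sd K], and is attached along the
   neighbourhood, inside this link, of the vertices that belong to [A]. If that
   neighbourhood has a Morse shelling, coning it turns its first tile into a
   regular one and each further critical tile of index [k] into one of index
   [k + 1]; the rest of the star is then added by cones over tiles that are not
   in the neighbourhood, which are always regular. Neighbourhoods are themselves
   shelled by adding stars one at a time, so everything reduces to counting
   critical tiles over posets. The proper faces of a critical face [y] of
   dimension [k] give one critical tile, of index [k]. The other two posets give
   none: for the upper face of a pair, the proper faces without a ridge, which
   is conically contractible; for the lower face, a poset in which the upper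
   face is comparable to everything. *)

Set Implicit Arguments.
Unset Strict Implicit.
Unset Printing Implicit Defensive.

(** * Tile codes *)

Section Tiles.
Local Open Scope set_scope.
Local Open Scope nat_scope.
Variable W : finType.
Implicit Types (r m s phi psi : {set W}) (M X Y E : simplices W) (a : W).

(* [(r, m, s)] with [r \subset m \proper s] encodes the faces of [s] that contain
   [r] and are not contained in [m]. Every Morse tile but the closed simplex is
   of this form; it is critical iff [r = m], and its index is then [#|r|]. *)
Definition tile_code := ({set W} * {set W} * {set W})%type.
Implicit Types (t : tile_code) (l : seq tile_code).

Definition faces t : simplices W :=
  [set phi : {set W} | [&& t.1.1 \subset phi, phi \subset t.2 & ~~ (phi \subset t.1.2)]].

Definition wf_code t := (t.1.1 \subset t.1.2) && (t.1.2 \proper t.2).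

Definition critical_code t := t.1.1 == t.1.2.

Definition code_index t := #|t.1.1|.

Lemma facesE t phi :
  (phi \in faces t) =
  [&& t.1.1 \subset phi, phi \subset t.2 & ~~ (phi \subset t.1.2)].
Proof. by rewrite inE. Qed.

Lemma faces_neq0 t phi : phi \in faces t -> phi != set0.
Proof.
by rewrite facesE => /and3P[_ _]; apply: contraNneq => ->; rewrite sub0set.
Qed.

Lemma faces_top t : wf_code t -> t.2 \in faces t.
Proof.
move=> /andP[rm ms]; rewrite facesE subxx /=.
by rewrite (subset_trans rm (proper_sub ms)) proper_subn.
Qed.

Lemma ridges_setD1 s v : v \in s -> s :\ v \in ridges s.
Proof.
by move=> vs; rewrite !inE subD1set -add1n (cardsD1 v s) vs eqxx.
Qed.

Lemma ridgesP s m : m \in ridges s -> exists2 v, v \in s & m = s :\ v.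
Proof.
rewrite !inE => /andP[ms /eqP cm].
have /cards1P[v sv] : #|s :\: m| == 1.
  by rewrite cardsD (setIidPr ms) -cm subSnn.
have: v \in s :\: m by rewrite sv set11.
rewrite inE => /andP[vm vs]; exists v => //.
by rewrite -sv setDDr setDv set0U (setIidPr ms).
Qed.

Lemma restriction_set_ridges s M :
  M \subset ridges s -> M = [set s :\ v | v in restriction_set s M].
Proof.
move=> /subsetP Ms; apply/setP => m; apply/idP/imsetP.
  move=> mM; have [v vs em] := ridgesP (Ms _ mM).
  by exists v; rewrite // inE vs -em.
by case=> v; rewrite inE => /andP[_ ?] ->.
Qed.

Lemma setD1_inj s : {in s &, injective (fun v => s :\ v)}.
Proof.
move=> v w vs ws e; apply/eqP; apply: contraTT vs => vw.
by have := setD11 v s; rewrite e !inE vw /= => ->.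
Qed.

Lemma card_ridge_set s r : r \subset s -> #|[set s :\ v | v in r]| = #|r|.
Proof.
move=> /subsetP rs; apply: card_in_imset => v w /rs vs /rs ws.
exact: setD1_inj.
Qed.

Lemma restriction_set_sub s M : restriction_set s M \subset s.
Proof. by apply/subsetP => v; rewrite inE => /andP[]. Qed.

Lemma restriction_set_imset s r :
  r \subset s -> restriction_set s [set s :\ v | v in r] = r.
Proof.
move=> rs; apply/setP => v; rewrite inE; apply/andP/idP.
  by case=> vs /imsetP[w wr /setD1_inj -> //]; apply: (subsetP rs).
by move=> vr; split; [apply: (subsetP rs) | apply: imset_f].
Qed.

Lemma ridge_set_sub s r : r \subset s -> [set s :\ v | v in r] \subset ridges s.
Proof.
move=> /subsetP rs; apply/subsetP => _ /imsetP[v vr ->].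
exact/ridges_setD1/rs.
Qed.

(** A face of [s] avoids the ridge [s :\ v] exactly when it contains [v]. Missing ridges thus become
    a lower bound on faces, the component [r] of a code. *)
Lemma deprived_ridges s M phi : M \subset ridges s ->
  (phi \in deprived s M) = (restriction_set s M \subset phi) && (phi \subset s).
Proof.
move=> Ms; rewrite !inE andbC [RHS]andbC; case: (boolP (phi \subset s)) => //= ps.
apply/idP/subsetP.
  move=> h v; rewrite inE => /andP[vs vM]; apply: contraNT h => vphi.
  by apply/bigcupP; exists (s :\ v); rewrite // powersetE subsetD1 ps.
move=> h; apply/negP => /bigcupP[m mM]; rewrite powersetE => pm.
have [v vs em] := ridgesP (subsetP Ms _ mM).
have /(subsetP pm) : v \in phi by apply: h; rewrite inE vs -em.
by rewrite em setD11.
Qed.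

(** The missing ridges are opposite to the vertices of [r]. In codimension at least two [m] is the
    Morse face; in codimension one it is one more missing ridge. *)
Lemma faces_morse_tile t : wf_code t -> morse_tile (faces t).
Proof.
case: t => [[r m] s] /andP[/= rm ms].
have rs := subset_trans rm (proper_sub ms).
have cs : #|s| = #|s|.-1.+1.
  by rewrite prednK // (leq_ltn_trans _ (proper_card ms)).
pose M := [set s :\ v | v in r].
have Ms : M \subset ridges s by exact: ridge_set_sub.
have E : faces (r, m, s) = deprived s (m |: M).
  apply/setP => phi; have := deprived_ridges phi Ms.
  rewrite facesE /= restriction_set_imset // !inE bigcup_setU big_set1 !inE.
  by rewrite negb_or -!andbA => ->; rewrite andbA andbC.
have [c2|c1] := leqP (#|m| + 2) #|s|.
  exists #|s|.-1, #|M|, s, M; split => //; right; exists m.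
  by rewrite (proper_sub ms).
exists #|s|.-1, #|m |: M|, s, (m |: M); split; last by left.
split => //; rewrite subUset Ms sub1set !inE (proper_sub ms) /= andbT.
by rewrite eqn_leq proper_card //= -ltnS -addn2.
Qed.

Lemma faces_critical t : wf_code t -> critical_code t -> critical_tile (code_index t) (faces t).
Proof.
case: t => [[r m] s] /andP[/= rm ms] /eqP /= e; subst m; right.
have rs := proper_sub ms.
exists #|s|.-1, s, [set s :\ v | v in r]; rewrite /code_index /=.
have cs : #|s| = #|s|.-1.+1.
  by rewrite prednK // (leq_ltn_trans _ (proper_card ms)).
split; first by split; rewrite ?ridge_set_sub ?card_ridge_set.
  by rewrite -ltnS -cs proper_card.
apply/setP => phi; rewrite facesE inE deprived_ridges ?ridge_set_sub //.
by rewrite restriction_set_imset // powersetE [RHS]andbC -andbA.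
Qed.

(** All other critical tiles are deprived of the empty face. *)
Lemma critical_tile_closed k s : critical_tile k (powerset s) -> k = 0.
Proof.
case=> [[]//|[n [s' [M [_ _ e]]]]].
have : set0 \in powerset s by rewrite powersetE sub0set.
by rewrite e !inE sub0set.
Qed.

Lemma closed_critical s : s != set0 -> critical_tile 0 (powerset s).
Proof. by left; split=> //; exists s. Qed.

(** Two descriptions of one tile, the one by [r'] being critical. Adding to [r] a vertex outside
    [m], or to [r'] a vertex outside [r'], gives a face; comparing such faces equates the cardinals.
    The sets [r] and [r'] may differ: an open simplex is obtained from any of its ridges. *)
Lemma pinched_interval r m s r' : r \subset m -> m \proper s -> r' \proper s ->
  (forall phi, [&& r' \subset phi, phi \subset s & ~~ (phi \subset r')] =
               [&& r \subset phi, phi \subset s & ~~ (phi \subset m)]) ->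
  r == m /\ #|r'| = #|r|.
Proof.
move=> rm ms r's XE.
have rs := subset_trans rm (proper_sub ms).
have up y : y \in s -> y \notin m -> (r' \subset y |: r) && ~~ (y |: r \subset r').
  move=> ys ym; have := XE (y |: r).
  rewrite subsetUr subUset sub1set ys rs /= [X in _ = ~~ X]subUset sub1set.
  by rewrite (negbTE ym) /= => ->.
have up' x : x \in s -> x \notin r' -> (r \subset x |: r') && ~~ (x |: r' \subset m).
  move=> xs xr'; have := XE (x |: r').
  rewrite subsetUr subUset sub1set xs (proper_sub r's) /=.
  by rewrite subUset sub1set (negbTE xr') /= => /esym.
have [_ [y0 y0s y0m]] := properP ms.
have [_ [x0 x0s x0r']] := properP r's.
have cr : #|r| = #|r'|.
  apply/eqP; rewrite eqn_leq; apply/andP; split.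
    have /andP[h1 h2] := up' _ x0s x0r'.
    have : r \proper x0 |: r'.
      by rewrite properE h1; apply: contra h2 => /subset_trans; apply.
    by move/proper_card; rewrite cardsU1 x0r' /= add1n ltnS.
  have /andP[h1 h2] := up _ y0s y0m.
  have : r' \proper y0 |: r by rewrite properE h1.
  move/proper_card; rewrite cardsU1; case: (y0 \notin r) => /=.
    by rewrite add1n ltnS.
  by rewrite add0n => /ltnW.
split; last by rewrite cr.
(* Let [z] be in [m] but not in [r]. If [z] is not in [r'], then [r = r'], although [z |: r'] needs
   a vertex of [r'] outside [m]. Otherwise [z = y0], which is outside [m]. *)
rewrite eqEsubset rm /=; apply/subsetP => z zm; apply: contraTT isT => zr.
have zs := subsetP (proper_sub ms) _ zm.
have [zr'|zr'] := boolP (z \in r'); last first.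
  have /andP[_] := up' _ zs zr'; rewrite subUset sub1set zm /=.
  case/subsetPn => w wr' wm.
  have ws := subsetP (proper_sub r's) _ wr'.
  have wr : w \notin r by apply: contra wm => /(subsetP rm).
  have /andP[h1 _] := up _ ws wm.
  have /andP[h2 _] := up' _ zs zr'.
  have rr' : r \subset r'.
    apply/subsetP => u ur; have := subsetP h2 _ ur; rewrite !inE.
    by case/predU1P => [uz|//]; rewrite -uz ur in zr.
  by have := subset_cardP cr rr' w; rewrite wr' (negbTE wr).
have /andP[h1 _] := up _ y0s y0m.
have := subsetP h1 _ zr'; rewrite !inE (negbTE zr) orbF => /eqP e.
by rewrite -e zm in y0m.
Qed.

(** The top simplex is recovered as the largest face, then [pinched_interval] applies. This converse
    of [faces_critical] ensures that no tile is critical through another description. *)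
Lemma critical_faces t k :
  wf_code t -> critical_tile k (faces t) -> critical_code t /\ k = code_index t.
Proof.
case: t => [[r m] s] w [[_ [s' [_ e]]]|].
  have : set0 \in powerset s' by rewrite powersetE sub0set.
  by rewrite -e => /faces_neq0; rewrite eqxx.
move=> [n [s' [M [[cs' Ms <-] kn]]]]; set r' := restriction_set s' M => e.
have cr' : #|M| = #|r'|.
  by rewrite {1}(restriction_set_ridges Ms) card_ridge_set // restriction_set_sub.
have r's' : r' \proper s'.
  by rewrite properEcard restriction_set_sub -cr' cs' ltnS.
have XE phi : (phi \in faces (r, m, s)) =
    [&& r' \subset phi, phi \subset s' & ~~ (phi \subset r')].
  by rewrite e inE deprived_ridges // powersetE andbC andbA.
have {e} XE' phi : [&& r' \subset phi, phi \subset s' & ~~ (phi \subset r')] =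
    [&& r \subset phi, phi \subset s & ~~ (phi \subset m)].
  by rewrite -XE facesE.
have ss' : s = s'.
  have /andP[/= rm ms] := w.
  apply/eqP; rewrite eqEsubset.
  have /and3P[_ -> _] : [&& r' \subset s, s \subset s' & ~~ (s \subset r')].
    by rewrite XE' subxx (subset_trans rm (proper_sub ms)) proper_subn.
  have /and3P[_ -> _] // : [&& r \subset s', s' \subset s & ~~ (s' \subset m)].
  by rewrite -XE' subxx proper_sub // proper_subn.
have /andP[/= rm ms] := w; rewrite /critical_code /code_index /= cr'.
by move: r's' XE'; rewrite -ss'; apply: pinched_interval.
Qed.

End Tiles.

(** * Shellings by tile codes *)

Section ShellingLists.
Local Open Scope set_scope.
Local Open Scope nat_scope.
Variable W : finType.
Implicit Types (r m s phi psi : {set W}) (X Y E F N D : simplices W) (a : W).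
Implicit Types (t : tile_code W) (l d : seq (tile_code W)).

(** [X] is the earlier family. Equality being a case of inclusion, separated families are also
    disjoint. *)
Definition sep X Y := [forall phi in X, forall psi in Y, ~~ (psi \subset phi)].

Lemma sepP X Y :
  reflect (forall phi psi, phi \in X -> psi \in Y -> ~~ (psi \subset phi)) (sep X Y).
Proof.
apply: (iffP 'forall_in_forall_inP) => h phi; last by move=> ? ?; apply: h.
by move=> psi ? ?; apply: h.
Qed.

(* A shelling of the family [E] inside the complex [F]: when a tile comes, its
   faces meet only faces of [F :\: E] and of the earlier tiles. *)
Definition shells F E l : Prop :=
  [/\ all (@wf_code W) l, pairwise sep (map (@faces W) l),
      forall phi, (phi \in E) = has (fun t => phi \in faces t) l
    & all (fun t => maxset (mem F) t.2) l].

Definition crits l := [seq code_index t | t <- l & critical_code t].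

Lemma crits_cat l d : crits (l ++ d) = crits l ++ crits d.
Proof. by rewrite /crits filter_cat map_cat. Qed.

Lemma shells_nil F : shells F set0 [::].
Proof. by split=> // phi; rewrite inE. Qed.

Lemma shells_sub F E l t : shells F E l -> t \in l -> faces t \subset E.
Proof.
by case=> _ _ cov _ tl; apply/subsetP => phi ft; rewrite cov; apply/hasP; exists t.
Qed.

Lemma shells_weaken F F' E l :
  (forall s, maxset (mem F) s -> maxset (mem F') s) ->
  shells F E l -> shells F' E l.
Proof. by move=> FF' [w p c mx]; split=> //; apply/allP => t tl; apply/FF'/(allP mx). Qed.

Lemma shells_cat F E E' l d : sep E E' ->
  shells F E l -> shells F E' d -> shells F (E :|: E') (l ++ d).
Proof.
move=> /sepP s sl sd; have [w p c m] := sl; have [w' p' c' m'] := sd.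
split; rewrite ?all_cat ?w ?m //.
  rewrite map_cat pairwise_cat p p' !andbT; apply/allrelP => X Y.
  move=> /mapP[t tl ->] /mapP[u ud ->]; apply/sepP => phi psi pt pu; apply: s.
    exact: (subsetP (shells_sub sl tl)).
  exact: (subsetP (shells_sub sd ud)).
by move=> phi; rewrite has_cat inE c c'.
Qed.

(** Each nonempty face of the first simplex is in [E], and no later tile may contain it, so only the
    empty face is missing. The first tile is thus critical of index 0. *)
Lemma shells_head F E t l :
  (forall phi psi, phi \in E -> psi \subset phi -> psi != set0 -> psi \in E) ->
  shells F E (t :: l) -> t = (set0, set0, t.2).
Proof.
move=> dE sl; have [/= /andP[w _] /andP[/allP p _] c _] := sl.
have sub phi : phi \subset t.2 -> phi != set0 -> phi \in faces t.
  move=> pt p0; have : phi \in E.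
    apply: dE pt p0; rewrite c /= faces_top //.
  rewrite c /= => /orP[//|/hasP[u ul pu]].
  have /sepP/(_ t.2 phi (faces_top w) pu) := p _ (map_f (@faces W) ul).
  by rewrite pt.
case: t w sub {sl p c} => [[r m] s] /andP[/= rm ms] sub.
suff m0 : m = set0 by move: rm; rewrite m0 subset0 => /eqP ->.
apply/eqP; rewrite -subset0; apply/subsetP => x xm.
have xs := subsetP (proper_sub ms) _ xm.
have /sub : [set x] \subset s by rewrite sub1set.
have x0 : [set x] != set0 by apply/set0Pn; exists x; rewrite set11.
by move=> /(_ x0); rewrite facesE /= [_ \subset m]sub1set xm !andbF.
Qed.

(** Two joins of a tile with a new vertex [a]. [susp] keeps only the faces through [a], which raises
    the index by one; [cone] keeps those without [a] too, and is never critical since [a] enters [m]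
    but not [r]. *)
Definition susp a t : tile_code W := (a |: t.1.1, a |: t.1.2, a |: t.2).

Definition cone a t : tile_code W := (t.1.1, a |: t.1.2, a |: t.2).

Lemma faces_cone a t phi :
  a \notin t.1.1 -> (phi \in faces (cone a t)) = (phi :\ a \in faces t).
Proof. by move=> ar; rewrite !facesE /= subsetD1 ar andbT !subDset. Qed.

Lemma faces_susp a t phi :
  a \notin t.1.1 ->
  (phi \in faces (susp a t)) = (a \in phi) && (phi :\ a \in faces t).
Proof.
move=> ar; rewrite !facesE /= subsetD1 ar andbT !subDset subUset sub1set.
by rewrite -andbA.
Qed.

Lemma wf_code_notin a t : wf_code t -> a \notin t.2 -> (a \notin t.1.1) && (a \notin t.1.2).
Proof.
move=> /andP[rm /proper_sub ms] h.
by rewrite !(contra _ h) //; apply: subsetP => //; apply: subset_trans ms.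
Qed.

Lemma properU1 a m s : a \notin s -> m \proper s -> a |: m \proper a |: s.
Proof.
move=> as_ ms; rewrite properE (setUS _ (proper_sub ms)) /=.
apply: contra (proper_subn ms) => /subsetP h; apply/subsetP => x xs.
have := h x; rewrite !inE xs orbT => /(_ isT)/predU1P[xa|//].
by rewrite -xa xs in as_.
Qed.

Lemma wf_code_susp a t : a \notin t.2 -> wf_code t -> wf_code (susp a t).
Proof. by move=> a2 /andP[h1 h2]; rewrite /wf_code /= setUS // properU1. Qed.

Lemma wf_code_cone a t : a \notin t.2 -> wf_code t -> wf_code (cone a t).
Proof.
move=> a2 /andP[h1 h2]; rewrite /wf_code /= properU1 // andbT.
by rewrite (subset_trans h1) // subsetUr.
Qed.

Lemma critical_code_susp a t : wf_code t -> a \notin t.2 -> critical_code (susp a t) = critical_code t.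
Proof.
move=> w a2; have /andP[h1 h2] := wf_code_notin w a2.
apply/eqP/eqP => /= [e|-> //].
by have /(congr1 (fun x => x :\ a)) := e; rewrite !setU1K.
Qed.

Lemma code_index_susp a t : wf_code t -> a \notin t.2 -> code_index (susp a t) = (code_index t).+1.
Proof.
by move=> w a2; have /andP[h1 h2] := wf_code_notin w a2; rewrite /code_index cardsU1 h1.
Qed.

Lemma critical_code_cone a t : wf_code t -> a \notin t.2 -> critical_code (cone a t) = false.
Proof.
move=> w a2; have /andP[h1 h2] := wf_code_notin w a2.
by apply/eqP => /= e; rewrite e setU11 in h1.
Qed.

Lemma crits_susp a l : all (@wf_code W) l -> all (fun t => a \notin t.2) l ->
  crits (map (susp a) l) = map S (crits l).
Proof.
rewrite /crits; elim: l => //= t l ih /andP[w wl] /andP[at_ al].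
by rewrite critical_code_susp //; case: ifP => _ /=; rewrite ?code_index_susp // ih.
Qed.

Lemma crits_cone a l : all (@wf_code W) l -> all (fun t => a \notin t.2) l ->
  crits (map (cone a) l) = [::].
Proof.
rewrite /crits; elim: l => //= t l ih /andP[w wl] /andP[at_ al].
by rewrite critical_code_cone ?ih.
Qed.

Lemma sep_remove a X Y X' Y' : sep X Y ->
  (forall phi, phi \in X' -> phi :\ a \in X) ->
  (forall phi, phi \in Y' -> phi :\ a \in Y) -> sep X' Y'.
Proof.
move=> /sepP s hX hY; apply/sepP => phi psi /hX px /hY py.
by apply: contra (s _ _ px py) => /setSD; apply.
Qed.

Lemma pairwise_sep_remove a (f : tile_code W -> tile_code W) l :
  (forall t phi, t \in l -> phi \in faces (f t) -> phi :\ a \in faces t) ->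
  pairwise sep (map (@faces W) l) -> pairwise sep (map (@faces W) (map f l)).
Proof.
elim: l => //= t l ih h /andP[al pl]; apply/andP; split; last first.
  by apply: ih => // u phi ul; apply: h; rewrite inE ul orbT.
apply/allP => _ /mapP[_ /mapP[u ul ->] ->].
apply: (sep_remove (a := a) (allP al _ (map_f _ ul))) => phi; apply: h.
  exact: mem_head.
by rewrite inE ul orbT.
Qed.

(** * Shellings of a cone from shellings of its base *)

Section Apex.
Variables (a : W) (F F' : simplices W).
Hypothesis apexF : forall s, maxset (mem F) s -> a \notin s /\ maxset (mem F') (a |: s).

Lemma shells_notin E l : shells F E l -> all (fun t => a \notin t.2) l.
Proof. by case=> _ _ _ m; apply/allP => t /(allP m)/apexF[]. Qed.

(** The head tile may contain [[set a]], whose trace on the base is empty and lies in no tile there,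
    so [sep_remove] does not apply. *)
Lemma sep_head s1 m t u : wf_code u -> a \notin u.2 ->
  (forall phi, phi \in faces (set0, m, a |: s1) -> phi :\ a \subset s1) ->
  (forall phi, phi \in faces t -> phi :\ a \in faces u) ->
  sep (faces (set0, set0, s1)) (faces u) ->
  sep (faces (set0, m, a |: s1)) (faces t).
Proof.
move=> w a2 h1 h2 /sepP s; apply/sepP => phi psi /h1 p1 /h2 p2.
have [p0|p0] := eqVneq (phi :\ a) set0.
  apply: contra (faces_neq0 p2) => /(setSD [set a]); rewrite p0.
  by rewrite -subset0.
apply: contra (s (phi :\ a) _ _ p2); first by move=> /setSD; apply.
by rewrite facesE /= sub0set p1 /= subset0.
Qed.

(** The cone is attached along [N], and [D] is the rest of its base. Suspending the first tile of
    [N] would leave out [[set a]]; absorbing it gives all faces of [a |: s1] through [a], a simplex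
    without one ridge, which is regular. The other tiles of [N] are suspended, those of [D]
    coned. *)
Lemma shells_suspension N D E s1 l d :
  shells F N ((set0, set0, s1) :: l) -> shells F D d -> sep N D ->
  (forall phi, (phi \in E) =
     ((a \in phi) && ((phi :\ a == set0) || (phi :\ a \in N))) || (phi :\ a \in D)) ->
  shells F' E ((set0, s1, a |: s1) :: map (susp a) l ++ map (cone a) d) /\
  crits ((set0, s1, a |: s1) :: map (susp a) l ++ map (cone a) d) = map S (crits l).
Proof.
move=> sN sD sND EE; have /= /andP[as1 al] := shells_notin sN.
have ad := shells_notin sD.
have [/= /andP[w1 wl] /andP[/allP p1 pl] cN /= /andP[m1 ml]] := sN.
have [wd pd cD md] := sD.
have ps1 : set0 \proper s1 by case/andP: w1.
have r_notin (k : seq (tile_code W)) t : all (@wf_code W) k ->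
    all (fun t => a \notin t.2) k -> t \in k -> a \notin t.1.1.
  move=> /allP w /allP h tk; by have /andP[] := wf_code_notin (w _ tk) (h _ tk).
have hl t phi : t \in l -> phi \in faces (susp a t) -> phi :\ a \in faces t.
  by move=> tl; rewrite faces_susp ?(r_notin l) // => /andP[].
have hd t phi : t \in d -> phi \in faces (cone a t) -> phi :\ a \in faces t.
  by move=> td; rewrite faces_cone ?(r_notin d).
have f1 phi : (phi \in faces (set0, s1, a |: s1)) = (a \in phi) && (phi :\ a \subset s1).
  rewrite facesE /= sub0set /= subDset [LHS]andbC; apply: andb_id2r => h.
  apply/idP/idP; last by apply: contraL => /subsetP p1s; apply: contra as1 => /p1s.
  apply: contraR => ap; apply/subsetP => x xp; have := subsetP h _ xp.
  by rewrite !inE => /predU1P[xa|//]; rewrite -xa xp in ap.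
split; last first.
  have c1 : critical_code (set0, s1, a |: s1) = false.
    by apply/eqP => /= e; rewrite -e properxx in ps1.
  by rewrite /crits /= c1 -/(crits _) crits_cat crits_susp // crits_cone // cats0.
split.
- rewrite /= all_cat !all_map; apply/and3P; split.
  + rewrite /wf_code /= sub0set properE subsetUr /=; apply: contra as1 => /subsetP; apply.
    by rewrite setU11.
  + by apply/allP => t tl; apply: wf_code_susp; [exact: (allP al)|exact: (allP wl)].
  + by apply/allP => t tl; apply: wf_code_cone; [exact: (allP ad)|exact: (allP wd)].
- rewrite /= !map_cat pairwise_cat all_cat; apply/and3P; split.
  + have h1 phi : phi \in faces (set0, s1, a |: s1) -> phi :\ a \subset s1.
      by rewrite f1 => /andP[].
    apply/andP; split; apply/allP => _ /mapP[_ /mapP[t tl ->] ->].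
      apply: (sep_head (u := t)) => //; rewrite ?(allP wl) ?(allP al) //.
        by move=> phi; apply: hl.
      exact/p1/map_f.
    apply: (sep_head (u := t)) => //; rewrite ?(allP wd) ?(allP ad) //.
      by move=> phi; apply: hd.
    apply/sepP => phi psi pp qq; apply: (sepP _ _ sND).
      by rewrite cN /= pp.
    by rewrite cD; apply/hasP; exists t.
  + apply/allrelP => X Y /mapP[_ /mapP[t tl ->] ->] /mapP[_ /mapP[u ud ->] ->].
    apply: (sep_remove (a := a) sND) => phi.
      by move=> /(hl _ _ tl) h; rewrite cN /=; apply/orP; right; apply/hasP; exists t.
    by move=> /(hd _ _ ud) h; rewrite cD; apply/hasP; exists u.
  + by rewrite !(pairwise_sep_remove (a := a)).
- move=> phi; rewrite EE /= has_cat !has_map f1 cN cD /= orbA [RHS]orbA; congr orb; last first.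
    apply: eq_in_has => t td /=; by rewrite faces_cone ?(r_notin d).
  rewrite andb_orr; congr orb.
    congr andb; rewrite facesE /= sub0set /= subset0.
    by case: eqVneq => [->|_] /=; rewrite ?sub0set ?andbT.
  case ap: (a \in phi) => /=.
    by apply: eq_in_has => t tl /=; rewrite faces_susp ?(r_notin l) // ap.
  apply/esym/hasPn => t tl /=; by rewrite faces_susp ?(r_notin l) // ap.
- rewrite /= all_cat !all_map (apexF m1).2 /=; apply/andP; split; apply/allP => t.
    by move=> /(allP ml)/apexF[].
  by move=> /(allP md)/apexF[].
Qed.

(** The cone is attached along nothing: the first tile absorbs [[set a]] and remains a simplex
    without its empty face, and the cones over the other tiles are regular. *)
Lemma shells_cone N E s1 l :
  shells F N ((set0, set0, s1) :: l) ->
  (forall phi, (phi \in E) =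
     ((a \in phi) && (phi :\ a == set0)) || (phi :\ a \in N)) ->
  shells F' E ((set0, set0, a |: s1) :: map (cone a) l) /\
  crits ((set0, set0, a |: s1) :: map (cone a) l) = [:: 0].
Proof.
move=> sN EE; have /= /andP[as1 al] := shells_notin sN.
have [/= /andP[w1 wl] /andP[/allP p1 pl] cN /= /andP[m1 ml]] := sN.
have ps1 : set0 \proper s1 by case/andP: w1.
have r_notin t : t \in l -> a \notin t.1.1.
  move=> tk; by have /andP[] := wf_code_notin (allP wl _ tk) (allP al _ tk).
have hl t phi : t \in l -> phi \in faces (cone a t) -> phi :\ a \in faces t.
  by move=> tl; rewrite faces_cone ?r_notin.
split; last first.
  rewrite /crits /= [critical_code _]eqxx /= -/(crits _).
  by rewrite crits_cone // /code_index cards0.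
split.
- rewrite /= !all_map; apply/andP; split.
    rewrite /wf_code /= sub0set properE sub0set /=; apply/subsetPn.
    by exists a; rewrite ?setU11 ?inE.
  by apply/allP => t tl; apply: wf_code_cone; [exact: (allP al)|exact: (allP wl)].
- rewrite /= (pairwise_sep_remove (a := a)) // andbT.
  apply/allP => _ /mapP[_ /mapP[t tl ->] ->].
  apply: (sep_head (u := t)) => //; rewrite ?(allP wl) ?(allP al) //.
  + by move=> phi; rewrite facesE /= subDset => /and3P[].
  + by move=> phi; apply: hl.
  + exact/p1/map_f.
- move=> phi; rewrite EE /= has_map cN /= orbA; congr orb; last first.
    apply: eq_in_has => t tl /=; by rewrite faces_cone ?r_notin.
  rewrite !facesE /= !sub0set /= !subset0 subDset.
  have [e|e] := eqVneq (phi :\ a) set0.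
    have -> : phi \subset a |: s1 by rewrite -subDset e sub0set.
    rewrite /= orbF andbT; apply/idP/idP; first by apply: contraTneq => ->; rewrite inE.
    apply: contraR => ap; rewrite -e eq_sym; apply/eqP/setP => x; rewrite !inE.
    by case: eqP => // ->; rewrite (negbTE ap).
  have -> : phi == set0 = false by apply: contraNF e => /eqP ->; rewrite set0D.
  by rewrite !andbT andbF.
- rewrite /= !all_map (apexF m1).2 /=; apply/allP => t.
  by move=> /(allP ml)/apexF[].
Qed.

End Apex.

End ShellingLists.

(** * Handles of the second subdivision *)

Section Handles.
Local Open Scope set_scope.
Local Open Scope nat_scope.
Variables (U : finType) (G : simplices U).
Hypothesis closedG : face_closed G.
Implicit Types (x y : U) (g c : {set U}) (A B : {set U}) (phi psi s : simplices U).
Implicit Types (l : seq nat).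

Definition flag phi : bool :=
  (phi \subset G) && [forall c in phi, forall d in phi, (c \subset d) || (d \subset c)].

(** For [g] in [G], this is the dual block of [g], a cone with apex [g] over [link g], which is the
    subdivision of the usual link. For a singleton it is the closed star of a vertex. *)
Definition star g : simplices {set U} :=
  [set phi | flag phi && [forall c in phi, g \subset c]].

Definition link g : simplices {set U} :=
  [set phi | flag phi && [forall c in phi, g \proper c]].

(** The vertices of the usual, unsubdivided link of [g]. *)
Definition verts g : {set U} := [set x | (x \notin g) && (x |: g \in G)].

Definition meets A phi : bool := [forall c in phi, c :&: A != set0].

(** In a nonempty flag [meets] bears on the least member alone. So for [A] disjoint from [g] this is
    the union of the blocks [star (x |: g)], [x] in [A], without the empty face. *)
Definition nbhd g A : simplices {set U} :=
  [set phi in link g | (phi != set0) && meets A phi].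

(* In the second subdivision, the faces that the star of the vertex [[set y]]
   adds to the union of the stars of the vertices [[set x]], [x \in A], are
   those of [handle [set y] A]. *)
Definition handle g A : simplices {set U} := [set phi in star g | ~~ meets A phi].

Definition handle_crits g A l : Prop :=
  exists2 ts, shells (star g) (handle g A) ts & crits ts = l.

(** The order of [l] is that of the shelling; it matters because coning drops the first entry. *)
Definition nbhd_crits g A l : Prop :=
  exists2 ts, shells (link g) (nbhd g A) ts & crits ts = l.

Lemma flagP phi :
  reflect ((forall c, c \in phi -> c \in G) /\
           (forall c d, c \in phi -> d \in phi -> (c \subset d) || (d \subset c)))
          (flag phi).
Proof.
apply: (iffP andP) => [[/subsetP h1 /forall_inP h2]|[h1 h2]]; split => //.
- by move=> c d /h2/forall_inP; apply.
- exact/subsetP.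
- by apply/forall_inP => c cp; apply/forall_inP => d dp; apply: h2.
Qed.

Lemma flag_sub phi psi : psi \subset phi -> flag phi -> flag psi.
Proof.
move=> /subsetP s /flagP[h1 h2]; apply/flagP; split=> [c /s/h1 //|c d /s cp /s dp].
exact: h2.
Qed.

Lemma starP g phi :
  reflect (flag phi /\ forall c, c \in phi -> g \subset c) (phi \in star g).
Proof. by rewrite inE; apply: (iffP andP) => -[? /forall_inP]. Qed.

Lemma linkP g phi :
  reflect (flag phi /\ forall c, c \in phi -> g \proper c) (phi \in link g).
Proof. by rewrite inE; apply: (iffP andP) => -[? /forall_inP]. Qed.

Lemma link_sub g phi psi : psi \subset phi -> phi \in link g -> psi \in link g.
Proof.
move=> s /linkP[f h]; apply/linkP; split; first exact: flag_sub s f.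
by move=> c /(subsetP s)/h.
Qed.

Lemma meetsP A phi :
  reflect (forall c, c \in phi -> exists2 x, x \in c & x \in A) (meets A phi).
Proof.
apply: (iffP forall_inP) => h c /h.
  by case/set0Pn => x; rewrite inE => /andP[]; exists x.
by case=> x xc xA; apply/set0Pn; exists x; rewrite inE xc.
Qed.

Lemma meetsPn A phi :
  reflect (exists2 c, c \in phi & [disjoint c & A]) (~~ meets A phi).
Proof.
by apply: (iffP forall_inPn) => -[c cp h]; exists c; rewrite ?negbK // ?setI_eq0 // -setI_eq0 -[_ == _]negbK.
Qed.

Lemma meets_sub A phi psi : psi \subset phi -> meets A phi -> meets A psi.
Proof. by move=> /subsetP s /meetsP h; apply/meetsP => c /s/h. Qed.

Lemma vertsS g x : x \in verts g -> verts (x |: g) \proper verts g.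
Proof.
move=> xg; apply/properP; split; last first.
  by exists x => //; rewrite !inE eqxx.
apply/subsetP => y; rewrite !inE negb_or => /andP[/andP[_ ->]] /= h.
by apply: closedG h _; rewrite setUS // subsetUr.
Qed.

Lemma link_verts g phi c :
  phi \in link g -> c \in phi -> exists2 x, x \in c & x \in verts g.
Proof.
move=> /linkP[/flagP[f _] h] cp; have /properP[gc [x xc xg]] := h _ cp.
exists x; rewrite // inE xg /=; apply: closedG (f _ cp) _.
by rewrite subUset sub1set xc.
Qed.

Lemma nbhd_verts g : nbhd g (verts g) = link g :\ set0.
Proof.
apply/setP => phi; rewrite !inE andbC -andbA; congr andb.
rewrite andbC; case: (boolP (flag phi && _)) => //= h.
by apply/meetsP => c; apply: link_verts; rewrite inE.
Qed.

Lemma nbhd0 g : nbhd g set0 = set0.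
Proof.
apply/setP => phi; rewrite !inE; apply/negP => /and3P[_ /set0Pn[c cp]].
by move=> /meetsP/(_ _ cp)[x]; rewrite inE.
Qed.

Lemma nbhd_down g A phi psi :
  phi \in nbhd g A -> psi \subset phi -> psi != set0 -> psi \in nbhd g A.
Proof.
move=> /setIdP[h1 /andP[_ h3]] s p0; apply/setIdP.
by split; [apply: link_sub s h1 | rewrite p0 (meets_sub s h3)].
Qed.

Lemma nbhd_mono g A B : A \subset B -> nbhd g A \subset nbhd g B.
Proof.
move=> /subsetP AB; apply/subsetP => phi; rewrite !inE => /and3P[-> -> /meetsP h] /=.
by apply/meetsP => c /h[x xc /AB]; exists x.
Qed.

(** A flag that is new when [x] joins [A] has a member [c0] disjoint from [A]. The members below
    [c0] meet [x |: A] but not [A], hence contain [x], and those above [c0] inherit it. *)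
Lemma handle_nbhd g A x : x \notin g ->
  handle (x |: g) A = nbhd g (x |: A) :\: nbhd g A.
Proof.
move=> xg; apply/setP => phi; rewrite in_setD; apply/setIdP/andP.
  case=> /starP[f h] nm; have [c0 c0p _] := meetsPn _ _ nm.
  have p0 : phi != set0 by apply/set0Pn; exists c0.
  split; first by rewrite inE (negbTE nm) !andbF.
  rewrite inE p0 /=; apply/andP; split.
    apply/linkP; split=> // c /h; rewrite subUset sub1set => /andP[xc gc].
    by apply/properP; split=> //; exists x.
  by apply/meetsP => c /h/subsetP hc; exists x; rewrite ?setU11 ?hc ?setU11.
rewrite !inE => -[nm /and3P[fl p0 m]].
have {nm} nm : ~~ meets A phi by move: nm; rewrite fl p0.
have /linkP[f h] : phi \in link g by rewrite inE.
split=> //; apply/andP; split=> //; apply/forall_inP => c cp.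
rewrite subUset sub1set (proper_sub (h _ cp)) andbT.
have [c0 c0p dc0] := meetsPn _ _ nm.
have sub_in d : d \in phi -> d \subset c0 -> x \in d.
  move=> dp dc; have /meetsP/(_ _ dp)[y yd] := m; rewrite !inE => /predU1P[<-//|yA].
  by have := disjointFr dc0 (subsetP dc _ yd); rewrite yA.
have /flagP[_ /(_ c c0 cp c0p)/orP[/sub_in -> //|/subsetP]] := f; apply.
exact: sub_in.
Qed.

(** A facet of the block contains its apex [x |: g]. A larger flag in [link g] has members
    comparable to the apex and strictly above [g], hence above the apex. *)
Lemma maxset_star_link g x s : x \notin g -> x |: g \in G ->
  maxset (mem (star (x |: g))) s -> maxset (mem (link g)) s.
Proof.
move=> xg xgG /maxsetP[/= /starP[fs hs] mx].
have gs : x |: g \in s.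
  suff <- : x |: g |: s = s by rewrite setU11.
  apply: mx; last exact: subsetUr.
  have /flagP[f1 f2] := fs; apply/starP; split.
    apply/flagP; split=> [c|c d]; first by rewrite in_setU1 => /predU1P[->|/f1].
    rewrite !in_setU1 => /predU1P[->|cs] /predU1P[->|ds]; rewrite ?subxx ?hs ?orbT //.
    exact: f2.
  by move=> c; rewrite in_setU1 => /predU1P[->|/hs].
apply/maxsetP; split=> [|s' /linkP[fs' hs'] ss'].
  apply/linkP; split=> // c /hs; rewrite subUset sub1set => /andP[xc gc].
  by apply/properP; split=> //; exists x.
apply: mx => //; apply/starP; split=> // c cs'.
have /flagP[_ /(_ _ _ cs' (subsetP ss' _ gs))/orP[cx|//]] := fs'.
have /properP[gc [y yc yg]] := hs' _ cs'.
rewrite subUset gc sub1set andbT; have := subsetP cx _ yc.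
by rewrite in_setU1 (negbTE yg) orbF => /eqP <-.
Qed.

Lemma star_link g phi : g \in G -> (phi \in star g) = (phi :\ g \in link g).
Proof.
move=> gG; apply/starP/linkP => -[f h]; split.
- exact: flag_sub (subD1set _ _) f.
- by move=> c; rewrite !inE => /andP[cg /h gc]; rewrite properEneq eq_sym cg.
- have hc c : c \in phi -> c \in G /\ g \subset c.
    move=> cp; have [->|cg] := eqVneq c g; first by [].
    have cp' : c \in phi :\ g by rewrite !inE cg.
    have /flagP[/(_ _ cp') ? _] := f; split=> //.
    exact/proper_sub/h.
  apply/flagP; split=> [c /hc[]//|c d cp dp].
  have [->|cg] := eqVneq c g; first by rewrite (hc _ dp).2.
  have [->|dg] := eqVneq d g; first by rewrite (hc _ cp).2 orbT.
  by have /flagP[_] := f; apply; rewrite !inE ?cg ?dg.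
- move=> c cp; have [->|cg] := eqVneq c g; first by [].
  by apply/proper_sub/h; rewrite !inE cg.
Qed.

Lemma maxset_link_star g s : g \in G -> maxset (mem (link g)) s ->
  g \notin s /\ maxset (mem (star g)) (g |: s).
Proof.
move=> gG /maxsetP[/= sl mx].
have gs : g \notin s.
  by apply: contraTN isT => gs; have /linkP[_ /(_ _ gs)] := sl; rewrite properxx.
split=> //; apply/maxsetP; split; first by rewrite /= star_link // setU1K.
move=> s' /=; rewrite star_link // subUset sub1set => s'l /andP[gs' ss'].
by rewrite -(setD1K gs') (mx _ s'l) // subsetD1 ss'.
Qed.

(** The apex [g] is disjoint from [A], so every flag through it is new. *)
Lemma handle_link g A phi : g \in G -> [disjoint g & A] ->
  (phi \in handle g A) =
  (phi :\ g \in link g) && ((g \in phi) || ~~ meets A (phi :\ g)).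
Proof.
move=> gG gA; rewrite inE star_link //; congr andb.
have [gp|gp] := boolP (g \in phi); first by apply/meetsPn; exists g.
suff -> : phi :\ g = phi by [].
by apply/setP => c; rewrite !inE; case: eqP => // ->; rewrite (negbTE gp).
Qed.

Lemma handle_verts g A : [disjoint g & A] -> handle g A = handle g (A :&: verts g).
Proof.
move=> gA; apply/setP => phi; rewrite !inE; apply: andb_id2l => /andP[/flagP[f _] h].
congr negb; apply/meetsP/meetsP => m c cp; have [x xc xA] := m _ cp.
  exists x; rewrite // !inE xA /=; rewrite (disjointFl gA) //=.
  apply: closedG (f _ cp) _; rewrite subUset sub1set xc /=.
  by move/forall_inP: h; apply.
by exists x => //; move: xA; rewrite inE => /andP[].
Qed.

Lemma handle_crits_verts g A l : [disjoint g & A] ->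
  handle_crits g (A :&: verts g) l -> handle_crits g A l.
Proof. by rewrite /handle_crits => /handle_verts ->. Qed.

Lemma shells_nbhdU g A x ts us : x \in verts g -> 
  shells (link g) (nbhd g A) ts ->
  shells (star (x |: g)) (handle (x |: g) A) us ->
  shells (link g) (nbhd g (x |: A)) (ts ++ us).
Proof.
rewrite inE => /andP[xg xgG] sN sH.
have -> : nbhd g (x |: A) = nbhd g A :|: handle (x |: g) A.
  by rewrite handle_nbhd // -{1}(setIidPr (nbhd_mono g (subsetUr [set x] A))) setID.
apply: shells_cat => //.
  apply/sepP => phi psi pN; rewrite handle_nbhd // in_setD => /andP[pN' pM].
  apply: contra pN' => s; apply: nbhd_down pN s _.
  by move: pM; rewrite inE => /and3P[].
by apply: shells_weaken sH => s; apply: maxset_star_link.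
Qed.

Lemma nbhd_crits0 g : nbhd_crits g set0 [::].
Proof. by exists [::]; rewrite // nbhd0; apply: shells_nil. Qed.

Lemma nbhd_critsU g A x l l' : x \in verts g ->
  nbhd_crits g A l -> handle_crits (x |: g) A l' -> nbhd_crits g (x |: A) (l ++ l').
Proof.
move=> xg [ts sts <-] [us sus <-]; exists (ts ++ us); last exact: crits_cat.
exact: shells_nbhdU.
Qed.

(** * Coning the shelling of a neighbourhood *)

Section Step.
Variable g : {set U}.
Hypothesis gG : g \in G.
Hypothesis deeper : forall x A, x \in verts g -> exists l, handle_crits (x |: g) A l.

(** The vertices of [B] outside [A] are added one at a time, through handles provided by [deeper].
    The critical tiles are not recorded, since these tiles will be coned. *)
Lemma shells_nbhdD A B : A \subset B -> B \subset verts g ->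
  exists ts, shells (link g) (nbhd g B :\: nbhd g A) ts.
Proof.
have [n] := ubnP #|B|; elim: n B => // n ih B cB AB Bg.
have [|/subsetPn[x xB xA]] := boolP (B \subset A).
  move=> BA; have -> : B = A by apply/eqP; rewrite eqEsubset BA.
  by exists [::]; rewrite setDv; apply: shells_nil.
have xg := subsetP Bg _ xB.
have AB' : A \subset B :\ x by rewrite subsetD1 AB.
have [|//||ts sts] := ih (B :\ x).
- by move: cB; rewrite (cardsD1 x B) xB.
- exact: subset_trans (subD1set _ _) Bg.
have [l [us sus _]] := deeper (B :\ x) xg.
have xg' : x \notin g by move: xg; rewrite inE => /andP[].
have xgG : x |: g \in G by move: xg; rewrite inE => /andP[].
have HE := handle_nbhd (B :\ x) xg'; rewrite setD1K // in HE.
exists (ts ++ us).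
have -> : nbhd g B :\: nbhd g A = (nbhd g (B :\ x) :\: nbhd g A) :|: handle (x |: g) (B :\ x).
  apply/setP => phi; rewrite HE !in_setU !in_setD.
  have /implyP := subsetP (nbhd_mono g AB') phi.
  have /implyP := subsetP (nbhd_mono g (subD1set B x)) phi.
  by do 3!case: (phi \in nbhd _ _).
apply: shells_cat => //.
  apply/sepP => phi psi; rewrite HE !in_setD => /andP[_ pN] /andP[pN' pM].
  apply: contra pN' => s; apply: nbhd_down pN s _.
  by move: pM; rewrite inE => /and3P[].
by apply: shells_weaken sus => s; apply: maxset_star_link.
Qed.

(** The flag reduced to [x |: g] shows that the neighbourhood is not empty, and [shells_head] gives
    the form of its first tile. *)
Lemma nbhd_head A ts : A != set0 -> A \subset verts g ->
  shells (link g) (nbhd g A) ts -> exists s us, ts = (set0, set0, s) :: us.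
Proof.
move=> /set0Pn[x xA] /subsetP/(_ _ xA); rewrite inE => /andP[xg xgG].
case: ts => [[_ _ c _]|t us sts].
  have : [set x |: g] \in nbhd g A.
    rewrite inE; apply/and3P; split.
    - apply/linkP; split.
        apply/flagP; split=> [c' /set1P -> //|c' d /set1P -> /set1P ->].
        by rewrite subxx.
      by move=> c' /set1P ->; apply/properP; split; [exact: subsetUr|exists x; rewrite ?setU11].
    - by apply/set0Pn; exists (x |: g); rewrite set11.
    - by apply/meetsP => c' /set1P ->; exists x; rewrite ?setU11.
  by rewrite c.
by exists t.2, us; rewrite -(shells_head (@nbhd_down g A) sts).
Qed.

(** The dropped entry [k] is the index of the first tile, necessarily 0. Any shelling of the rest of
    the link will do, as its tiles are coned. *)
Lemma handle_critsS A k l : A != set0 -> A \subset verts g ->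
  nbhd_crits g A (k :: l) -> handle_crits g A (map S l).
Proof.
move=> A0 Ag [ts sts cts]; have [s1 [us e]] := nbhd_head A0 Ag sts.
rewrite {ts}e in sts cts; have [ds sds] := shells_nbhdD Ag (subxx _).
have [||] := shells_suspension (F' := star g) (E := handle g A)
  (fun s => maxset_link_star gG) sts sds.
- apply/sepP => phi psi pN; rewrite in_setD => /andP[pN' pM].
  apply: contra pN' => s; apply: nbhd_down pN s _.
  by move: pM; rewrite inE => /and3P[].
- move=> phi; rewrite handle_link //; last first.
    rewrite disjoint_sym disjoint_subset; apply/subsetP => x /(subsetP Ag).
    by rewrite inE => /andP[].
  rewrite nbhd_verts in_setD in_setD1 [in X in _ = _ || X]inE.
  rewrite [_ \in nbhd g A]inE; set psi := phi :\ g.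
  have [->|p0] := eqVneq psi set0.
    rewrite /= !andbF !orbF andbT; have -> : set0 \in link g.
      apply/linkP; split; first by apply/flagP; split=> [c|c d]; rewrite inE.
      by move=> c; rewrite inE.
    have -> : meets A set0 by apply/meetsP => c; rewrite inE.
    by rewrite orbF.
  by case: (psi \in link g); case: (meets A psi); case: (g \in phi).
move=> sh cr; eexists; first exact: sh.
by rewrite cr; move: cts; rewrite /crits /= /critical_code /= eqxx => -[_ <-].
Qed.

Lemma handle_crits_set0 : handle_crits g set0 [:: 0].
Proof.
have g0 : [disjoint g & set0 : {set U}] by rewrite -setI_eq0 setI0.
have HE phi : (phi \in handle g set0) =
    ((g \in phi) && (phi :\ g == set0)) || (phi :\ g \in nbhd g (verts g)).
  rewrite handle_link // nbhd_verts in_setD1.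
  have [->|p0] := eqVneq (phi :\ g) set0.
    have -> : set0 \in link g.
      apply/linkP; split; first by apply/flagP; split=> [c|c d]; rewrite inE.
      by move=> c; rewrite inE.
    have -> : meets set0 (set0 : simplices U) by apply/meetsP => c; rewrite inE.
    by rewrite /= andbT !orbF.
  rewrite andbF /= andbC; case: (phi :\ g \in link g); rewrite ?andbF // andbT.
  apply/orP; right; apply/meetsPn.
  by have [c cp] := set0Pn _ p0; exists c => //; rewrite -setI_eq0 setI0.
(* Without link vertices the block is the single point [g], and there is no first tile to cone. *)
have [v0|v0] := eqVneq (verts g) set0.
  exists [:: (set0, set0, [set g])]; last first.
    by rewrite /crits /= /critical_code /= eqxx /= /code_index /= cards0.
  split=> //=.
  - by rewrite /wf_code /= sub0set proper0 andbT; apply/set0Pn; exists g; rewrite set11.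
  - move=> phi; rewrite HE v0 nbhd0 inE !orbF facesE /= sub0set /= subset0.
    rewrite subset1; have [->|p0] := eqVneq phi set0; first by rewrite !inE andbF.
    rewrite orbF andbT setD_eq0 subset1 (negbTE p0) orbF andbC.
    by case: eqP => // ->; rewrite set11.
  - rewrite andbT; apply/maxsetP; split=> [|s].
      by rewrite /= star_link // setDv; apply/linkP; split;
        [apply/flagP; split=> [c|c d]; rewrite inE|move=> c; rewrite inE].
    rewrite /= star_link // sub1set => sl gs; apply/eqP; rewrite eqEsubset sub1set gs.
    rewrite andbT -setD_eq0; apply: contraTT isT => /set0Pn[c cs].
    by have [x _] := link_verts sl cs; rewrite v0 inE.
have [ts sts] := shells_nbhdD (sub0set _) (subxx _).
rewrite nbhd0 setD0 in sts; have [s1 [us e]] := nbhd_head v0 (subxx _) sts.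
rewrite {ts}e in sts; have [] := shells_cone (F' := star g)
  (fun s => maxset_link_star gG) sts HE.
by eexists; eauto.
Qed.

End Step.

(** Induction on the number of link vertices, which drops when [g] grows. *)
Lemma handle_crits_exists g A : g \in G -> exists l, handle_crits g A l.
Proof.
have [n] := ubnP #|verts g|; elim: n g A => // n ih g A cg gG.
have deeper x B : x \in verts g -> exists l, handle_crits (x |: g) B l.
  move=> xg; apply: ih; last by move: xg; rewrite inE => /andP[].
  by rewrite (leq_trans (proper_card (vertsS xg))) // -ltnS.
(* If [A] meets [g], every member of the block meets [A], and nothing is new. *)
have [gA|gA] := boolP [disjoint g & A]; last first.
  exists [::], [::] => //; suff -> : handle g A = set0 by apply: shells_nil.
  apply/setP => phi; rewrite !inE; apply/negP => /andP[/andP[_ /forall_inP h]].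
  move=> /meetsPn[c cp cA]; case/negP: gA.
  by apply: disjointWl cA; apply: h.
have [e|A0] := eqVneq (A :&: verts g) set0.
  exists [:: 0]; apply: handle_crits_verts gA _; rewrite e.
  exact: handle_crits_set0.
have [ts] := shells_nbhdD deeper (sub0set _) (subsetIr A (verts g)).
rewrite nbhd0 setD0 => sts; have [s1 [us e]] := nbhd_head A0 (subsetIr _ _) sts.
exists (map S (crits us)); apply: handle_crits_verts gA _.
apply: (@handle_critsS g gG deeper _ 0 _ A0 (subsetIr _ _)).
by exists ts => //; rewrite e /crits /= /critical_code /= eqxx /= /code_index /= cards0.
Qed.

End Handles.

(** * Critical tiles over posets *)

Section Posets.
Local Open Scope set_scope.
Local Open Scope nat_scope.
Variables (T : finType) (K : simplices T).
Implicit Types (v : T) (s rho sigma tau b : {set T}) (g A B : {set {set T}}) (l : seq nat).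

Notation G := (sd K).

Definition nested s rho := (s \subset rho) || (rho \subset s).

Lemma nested_sym s rho : nested s rho = nested rho s.
Proof. exact: orbC. Qed.

Lemma sdP g :
  reflect ((forall s, s \in g -> s \in K :\ set0) /\
           (forall s rho, s \in g -> rho \in g -> nested s rho))
          (g \in sd K).
Proof.
rewrite inE; apply: (iffP andP) => [[/subsetP h1 /forall_inP h2]|[h1 h2]].
  by split => // s rho /h2/forall_inP; apply.
split; first exact/subsetP.
by apply/forall_inP => s sg; apply/forall_inP => rho; apply: h2.
Qed.

Lemma sd_closed : face_closed (sd K).
Proof.
move=> g h /sdP[g1 g2] /subsetP hg; apply/sdP; split=> [s /hg/g1 //|].
by move=> s rho /hg sg /hg; apply: g2.
Qed.

Lemma sd_setU1 g s : s \in K :\ set0 -> (forall rho, rho \in g -> nested rho s) ->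
  g \in sd K -> s |: g \in sd K.
Proof.
move=> sK sg /sdP[g1 g2]; apply/sdP; split=> [rho|rho1 rho2].
  by rewrite in_setU1 => /predU1P[->|/g1].
rewrite !in_setU1 => /predU1P[->|h1] /predU1P[->|h2].
- by rewrite /nested subxx.
- by rewrite nested_sym sg.
- exact: sg.
- exact: g2.
Qed.

Lemma vertsP g s : s \in verts G g ->
  [/\ s \notin g, s |: g \in sd K, s \in K :\ set0 &
      forall rho, rho \in g -> nested rho s].
Proof.
rewrite inE => /andP[sg sgG]; split=> //; have /sdP[h1 h2] := sgG.
  by apply: h1; rewrite setU11.
by move=> rho rg; apply: h2; rewrite ?setU11 // in_setU1 rg orbT.
Qed.

(** [sd K] is the clique complex of the relation [nested], so the link of a simplex is determined by
    comparabilities. *)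
Lemma vertsU1 g s rho : g \in G -> s \in verts G g ->
  (rho \in verts G (s |: g)) = [&& rho \in verts G g, rho != s & nested rho s].
Proof.
move=> gG sg; have [sg' sgG sK scomp] := vertsP sg.
apply/idP/and3P => [rs|[rg rs rcomp]].
  have [] := vertsP rs; rewrite in_setU1 negb_or => /andP[rs' rg] rsG rK rcomp.
  split=> //; last by rewrite nested_sym rcomp ?setU11.
  rewrite inE rg /=; apply: sd_closed rsG _.
  by rewrite setUS // subsetUr.
have [rg' _ rK rc] := vertsP rg.
rewrite inE in_setU1 negb_or rs rg' /=; apply: sd_setU1 => // t.
by rewrite in_setU1 => /predU1P[->|/rc //]; rewrite nested_sym.
Qed.

Notation hC := (handle_crits G).
Notation nC := (nbhd_crits G).

Lemma handle_crits_nbhd g A k l : g \in G -> A \subset verts G g ->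
  nC g A (k :: l) -> hC g A (map S l).
Proof.
(* An empty [A] has an empty neighbourhood, whereas [k :: l] requires a tile. *)
move=> gG Ag nA; have [A0|A0] := eqVneq A set0.
  case: nA; rewrite A0 nbhd0 => -[|t ts] // [/= /andP[w _] _ /(_ t.2)].
  by rewrite inE /= faces_top.
apply: handle_critsS nA => //; first exact: sd_closed.
move=> s B sg; apply: handle_crits_exists; first exact: sd_closed.
by have [] := vertsP sg.
Qed.

Lemma handle_crits0 g : g \in G -> hC g set0 [:: 0].
Proof.
move=> gG; apply: handle_crits_set0 => //; first exact: sd_closed.
move=> s B sg; apply: handle_crits_exists; first exact: sd_closed.
by have [] := vertsP sg.
Qed.

(** Elements of [A] not comparable to [s] lie in no member of the block of [s |: g]. *)
Lemma handle_crits_nested g A s l : g \in G -> s \in verts G g ->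
  A \subset verts G g -> s \notin A ->
  hC (s |: g) [set rho in A | nested rho s] l -> hC (s |: g) A l.
Proof.
move=> gG sg /subsetP Ag sA h; apply: handle_crits_verts; first exact: sd_closed.
  rewrite -setI_eq0; apply/eqP/setP => rho; rewrite in_set0 in_setI in_setU1.
  apply/negP => /andP[/predU1P[->|rg] rA]; first by rewrite rA in sA.
  by have [] := vertsP (Ag _ rA); rewrite rg.
suff -> : A :&: verts G (s |: g) = [set rho in A | nested rho s] by [].
apply/setP => rho; rewrite in_setI vertsU1 // [in RHS]inE.
apply: andb_id2l => rA; rewrite Ag //=; have -> // : rho != s.
by apply: contraTneq rA => ->.
Qed.

Lemma nbhd_critsU1 g A s l l' : g \in G -> s |: A \subset verts G g -> s \notin A ->
  nC g A l -> hC (s |: g) [set rho in A | nested rho s] l' ->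
  nC g (s |: A) (l ++ l').
Proof.
move=> gG; rewrite subUset sub1set => /andP[sg Ag] sA nA hA.
apply: nbhd_critsU => //.
exact: handle_crits_nested.
Qed.

(** Start from [tau] alone and add the other elements. Those comparable to a new [s] again contain
    the cone point [tau]; by induction their neighbourhood has one critical tile, which coning makes
    regular. *)
Lemma cone_crits g A tau : g \in G -> A \subset verts G g -> tau \in A ->
  (forall rho, rho \in A -> nested rho tau) -> nC g A [:: 0].
Proof.
have [n] := ubnP #|A|; elim: n g A => // n ih g A cA gG Ag tA At.
have [e|/subsetPn[s sA]] := boolP (A \subset [set tau]).
  have -> : A = tau |: set0.
    by apply/eqP; rewrite eqEsubset setU0 e sub1set.
  have tg := subsetP Ag _ tA; have [_ tgG _ _] := vertsP tg.
  apply: (nbhd_critsU (l := [::])) => //.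
    exact: nbhd_crits0.
  exact: handle_crits0.
rewrite inE => st; have sg := subsetP Ag _ sA; have [_ sgG _ _] := vertsP sg.
have cA' : #|A :\ s| < n by move: cA; rewrite (cardsD1 s A) sA.
have tA' : tau \in A :\ s by rewrite !inE eq_sym st.
rewrite -(setD1K sA) -[[:: 0]]cats0; apply: nbhd_critsU1; rewrite ?setD1K ?setD11 //.
  apply: ih => //; first by apply: subset_trans Ag; apply: subD1set.
  by move=> rho; rewrite in_setD1 => /andP[_]; apply: At.
apply: (@handle_crits_nbhd _ _ 0 [::]) => //.
  apply/subsetP => rho /setIdP[]; rewrite in_setD1 => /andP[rs rA] rc.
  by rewrite vertsU1 // (subsetP Ag) // rs.
apply: ih => //.
- by apply: leq_ltn_trans cA'; apply/subset_leq_card/subsetP => rho /setIdP[].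
- apply/subsetP => rho /setIdP[]; rewrite in_setD1 => /andP[rs rA] rc.
  by rewrite vertsU1 // (subsetP Ag) // rs.
- by rewrite inE tA' nested_sym At.
- by move=> rho /setIdP[]; rewrite in_setD1 => /andP[_ /At].
Qed.

(* The poset is conically contractible through [rho <= v |: rho >= v |: b]. *)
Definition punctured tau v b : {set {set T}} :=
  [set rho : {set T} | [&& b \proper rho, rho \proper tau & rho != tau :\ v]].

(** The elements through [v] form a cone. The others are added from the largest down; above such a
    [rho] the poset is again punctured, with [rho] in place of [b], so by induction its handle has
    no critical tile. *)
Lemma punctured_crits g tau v b : g \in G -> v \in tau -> b \proper tau :\ v ->
  punctured tau v b \subset verts G g -> nC g (punctured tau v b) [:: 0].
Proof.
have [n] := ubnP (#|tau| - #|b|); elim: n g b => // n ih g b cb gG vt bt Qg.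
set Q := punctured tau v b in Qg *.
have /properP[] := bt; rewrite subsetD1 => /andP[bt' vb] [x].
rewrite !inE => /andP[xv xt] xb.
(* The least element of [B] is [v |: b]; the vertex [x] shows that it is not [tau]. *)
pose B := [set rho in Q | v \in rho].
have BQ : B \subset Q by apply/subsetP => rho /setIdP[].
have nB : nC g B [:: 0].
  apply: (cone_crits (tau := v |: b)) => //.
  - exact: subset_trans Qg.
  - rewrite !inE eqxx andbT; apply/and3P; split.
    + by apply/properP; split; [exact: subsetUr | exists v; rewrite ?setU11].
    + apply/properP; split; first by rewrite subUset sub1set vt.
      by exists x; rewrite // !inE negb_or xv.
    + by apply: contraTneq (setU11 v b) => ->; rewrite !inE eqxx.
  - move=> rho /setIdP[]; rewrite inE => /and3P[/proper_sub br _ _] vr.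
    by rewrite /nested orbC subUset sub1set vr br.
(* [A] runs over the upper sets between [B] and [Q], so that elements are removed from the
   bottom. *)
suff H A : B \subset A -> A \subset Q ->
    (forall rho rho', rho \in A -> rho' \in Q -> rho \subset rho' -> rho' \in A) ->
    nC g A [:: 0] by apply: H.
have [m] := ubnP #|A|; elim: m A => // m ihA A cA BA AQ up.
have [AB|/subsetPn[rho0 r0A r0B]] := boolP (A \subset B).
  by have -> : A = B by apply/eqP; rewrite eqEsubset AB.
have r0 : rho0 \in A :\: B by rewrite inE r0B.
(* What lies below [rho] lacks [v] too, so minimal size in [A :\: B] implies minimality in [A]. *)
case: (arg_minnP (fun rho : {set T} => #|rho|) r0) => rho rAB rmin.
have /setDP[rA rB] := rAB.
have below rho1 : rho1 \in A -> rho1 \subset rho -> rho1 = rho.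
  move=> r1A r1r; apply/eqP; rewrite eqEcard r1r; apply: rmin; apply/setDP; split=> //.
  apply: contra rB => /setIdP[_ vr]; rewrite inE (subsetP AQ) //=.
  exact: subsetP r1r _ vr.
have rQ := subsetP AQ _ rA; have rg := subsetP Qg _ rQ.
have [_ rgG _ _] := vertsP rg.
have vr : v \notin rho by apply: contra rB => vr; rewrite inE rQ.
have /and3P[br rt rtv] : [&& b \proper rho, rho \proper tau & rho != tau :\ v].
  by move: rQ; rewrite inE.
have rtv' : rho \proper tau :\ v.
  by rewrite properEneq rtv subsetD1 vr proper_sub.
have Qr : [set rho1 in A :\ rho | nested rho1 rho] = punctured tau v rho.
  apply/setP => rho1; rewrite !inE; apply/andP/and3P.
    case=> /andP[r1r r1A] /orP[/(below _ r1A) e|rr1]; first by rewrite e eqxx in r1r.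
    have := subsetP AQ _ r1A; rewrite inE => /and3P[_ -> ->]; split => //.
    by rewrite properEneq eq_sym r1r.
  case=> rr1 r1t r1tv; split; last by rewrite /nested (proper_sub rr1) orbT.
  rewrite eq_sym (proper_neq rr1) /=; apply: up rA _ (proper_sub rr1).
  by rewrite inE r1t r1tv (proper_trans br).
rewrite -(setD1K rA) -[[:: 0]]cats0; apply: nbhd_critsU1.
- by [].
- by rewrite setD1K //; apply: subset_trans Qg.
- by rewrite setD11.
- apply: ihA.
  + by move: cA; rewrite (cardsD1 rho A) rA.
  + rewrite subsetD1 BA /=; apply: contra vr => /setIdP[_ //].
  + by apply: subset_trans AQ; apply: subD1set.
  + move=> rho1 rho2; rewrite !in_setD1 => /andP[r1r r1A] r2Q r12.
    rewrite (up rho1) // andbT; apply: contraNneq r1r => e.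
    by apply/eqP/below => //; rewrite -e.
rewrite Qr; have Qrg : punctured tau v rho \subset verts G (rho |: g).
  rewrite -Qr; apply/subsetP => rho1 /setIdP[]; rewrite in_setD1 => /andP[r1r r1A] rc.
  by rewrite vertsU1 // r1r rc (subsetP Qg) // (subsetP AQ).
apply: (@handle_crits_nbhd _ _ 0 [::]) => //; apply: ih => //.
rewrite -ltnS; apply: leq_trans cb; rewrite ltnS.
by rewrite ltn_sub2l ?proper_card // (proper_trans br).
Qed.

Definition boundary sigma : {set {set T}} :=
  [set rho : {set T} | (rho != set0) && (rho \proper sigma)].

(** All proper faces but the ridge [sigma'] form a punctured poset, which gives [[:: 0]]. The ridge
    then sees its own boundary and contributes its index by induction. Coning drops the 0 and raises
    the other index. *)
Lemma boundary_crits g sigma k : #|sigma| = k.+1 -> g \in G ->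
  boundary sigma \subset verts G g -> hC g (boundary sigma) [:: k].
Proof.
elim: k g sigma => [|k ih] g sigma cs gG bg.
  suff -> : boundary sigma = set0 by apply: handle_crits0.
  apply/setP => rho; rewrite !inE; apply/negP => /andP[r0 /proper_card].
  by rewrite cs ltnS leqn0 cards_eq0 (negbTE r0).
have /card_gt0P[v vs] : 0 < #|sigma| by rewrite cs.
have cs' : #|sigma :\ v| = k.+1.
  by move: cs; rewrite (cardsD1 v) vs => -[].
set sigma' := sigma :\ v in cs' *.
have s's : sigma' \proper sigma by rewrite properD1.
have s'0 : sigma' != set0 by rewrite -cards_eq0 cs'.
have bE : boundary sigma = sigma' |: punctured sigma v set0.
  apply/setP => rho; rewrite in_setU1 !inE proper0 -/sigma'.
  by have [->|] := eqVneq rho sigma'; rewrite ?s'0 ?s's ?andbT.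
have s'g : sigma' \in verts G g by apply: (subsetP bg); rewrite bE setU11.
have [_ s'gG _ _] := vertsP s'g.
have Qg : punctured sigma v set0 \subset verts G g.
  by apply: subset_trans bg; rewrite bE subsetUr.
have s'Q : sigma' \notin punctured sigma v set0 by rewrite inE eqxx !andbF.
have Qb : [set rho in punctured sigma v set0 | nested rho sigma'] = boundary sigma'.
  apply/setP => rho; rewrite !inE proper0 -/sigma'; apply/andP/andP.
    case=> /and3P[r0 rs rs'] /orP[h|h]; split=> //; first by rewrite properEneq rs'.
    move: rs'; rewrite eq_sym eqEcard h /= -ltnNge cs'.
    by have := proper_card rs; rewrite cs ltnS => h1 h2; have := leq_trans h2 h1; rewrite ltnn.
  case=> r0 rs; rewrite r0 (proper_trans rs s's) proper_neq //=; split=> //.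
  by rewrite /nested proper_sub.
apply: (@handle_crits_nbhd _ _ 0 [:: k]) => //.
rewrite bE -[[:: 0; k]]/([:: 0] ++ [:: k]); apply: nbhd_critsU1 => //.
- by rewrite -bE.
- by apply: punctured_crits => //; rewrite proper0.
rewrite Qb; apply: ih => //.
apply/subsetP => rho; rewrite -Qb => /setIdP[rQ rc].
by rewrite vertsU1 // rc (subsetP Qg) //=; rewrite andbT; apply: contraTneq rQ => ->.
Qed.

End Posets.

(** * From codes to Morse shellings *)

Section Realization.
Import Order.TTheory GRing.Theory Num.Theory.
Variables (R : realType) (W : finType).
Implicit Types (s : {set W}) (X Y S : simplices W).
Local Open Scope ring_scope.

Lemma realization_neq0 S s : s != set0 -> s \in S ->
  exists x : {ffun W -> R}, @realization W R S x.
Proof.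
move=> s0 sS; have c0 : #|s|%:R != 0 :> R by rewrite pnatr_eq0 cards_eq0.
(* The barycentre of [s]. *)
exists [ffun v => if v \in s then (#|s|%:R)^-1 else 0]; split.
- by move=> v; rewrite ffunE; case: ifP; rewrite ?invr_ge0 ?ler0n.
- under eq_bigr do rewrite ffunE.
  by rewrite -big_mkcond /= sumr_const -[_ *+ _]mulr_natl mulfV.
- suff -> : [set v | [ffun v => if v \in s then (#|s|%:R)^-1 else 0] v != 0 :> R] = s by [].
  by apply/setP => v; rewrite inE ffunE; case: ifP; rewrite ?invr_eq0 ?c0 ?eqxx.
Qed.

(** Membership of a point depends on its support alone, so a partition of the faces suffices. *)
Lemma realization_partition (P : {set simplices W}) S :
  (forall X, X \in P -> exists2 s, s != set0 & s \in X) ->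
  (forall X Y s, X \in P -> Y \in P -> s \in X -> s \in Y -> X = Y) ->
  (forall s, s \in S <-> exists2 X, X \in P & s \in X) ->
  classical_sets.partition (fun X => X \in P) (@realization W R) (@realization W R S).
Proof.
move=> ne dj cov; split.
- apply/classical_sets.seteqP; split=> x.
    by case=> X XP [x0 x1 xX]; split=> //; apply/cov; exists X.
  by case=> x0 x1 /cov[X XP xX]; exists X.
- by move=> X Y XP YP [x [[_ _ xX] [_ _ xY]]]; apply: dj xX xY.
- by move=> X /ne[s s0 /(realization_neq0 s0)].
Qed.

End Realization.

(** * From a separated list of tiles to a filtration by subcomplexes *)

Section Assembly.
Local Open Scope set_scope.
Local Open Scope nat_scope.
Variables (W : finType) (S : simplices W).
Hypotheses (closedS : face_closed S) (S0 : set0 \in S).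
Implicit Types (s phi psi : {set W}) (X Y : simplices W) (t : tile_code W).
Implicit Types (Xs ts : seq (simplices W)).

Definition prefix_union Xs p : simplices W := [set phi | has (fun X => phi \in X) (take p Xs)].

Lemma sep_neq X Y : X != set0 -> sep X Y -> X != Y.
Proof.
move=> /set0Pn[phi pX] /sepP h; apply: contraTneq isT => e.
by have := h phi phi pX; rewrite -e subxx => /(_ pX).
Qed.

Lemma pairwise_sep_uniq Xs : all (fun X => X != set0) Xs -> pairwise (@sep W) Xs -> uniq Xs.
Proof.
move=> ne pw; rewrite uniq_pairwise.
apply: sub_in_pairwise ne pw => X Y X0 _; exact: sep_neq.
Qed.

Section Seq.
Variable Xs : seq (simplices W).
Hypothesis pw : pairwise (@sep W) Xs.

Lemma sep_nth i j phi psi : i < j -> j < size Xs ->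
  phi \in nth set0 Xs i -> psi \in nth set0 Xs j -> ~~ (psi \subset phi).
Proof.
move=> ij js; have /(pairwiseP set0)/(_ i j) := pw; rewrite !inE.
by move=> /(_ (ltn_trans ij js) js ij) /sepP; apply.
Qed.

Lemma sep_disjoint X Y phi : X \in Xs -> Y \in Xs -> phi \in X -> phi \in Y -> X = Y.
Proof.
move=> /(nthP set0)[i is_ <-] /(nthP set0)[j js <-] pX pY.
by case: (ltngtP i j) => [ij|ji|-> //];
  [have := sep_nth ij js pX pY | have := sep_nth ji is_ pY pX]; rewrite subxx.
Qed.

Hypothesis cov : forall phi, (phi \in S) = has (fun X => phi \in X) Xs.

(** A face of a face of an early tile lies in some tile, which separation prevents from coming
    later. *)
Lemma prefix_closed p : face_closed (prefix_union Xs p).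
Proof.
move=> phi psi; rewrite !inE => /hasP[X /(nthP set0)[i]].
rewrite size_take_min leq_min => /andP[ip is_]; rewrite nth_take // => <- pX pp.
have : psi \in S.
  apply: closedS pp; rewrite cov; apply/hasP.
  by exists (nth set0 Xs i); rewrite ?mem_nth.
rewrite cov => /hasP[Y /(nthP set0)[j js <-] pY]; apply/hasP.
exists (nth set0 Xs j) => //; have [jp|pj] := ltnP j p.
  by rewrite -(nth_take _ jp) mem_nth // size_take_min leq_min jp.
by have := sep_nth (leq_trans ip pj) js pX pY; rewrite pp.
Qed.

Lemma prefix_sub p : prefix_union Xs p \subset S.
Proof.
apply/subsetP => phi; rewrite inE cov => /hasP[X /mem_take XX pX].
by apply/hasP; exists X.
Qed.

Lemma prefixS p : p < size Xs ->
  prefix_union Xs p \subset prefix_union Xs p.+1 /\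
  prefix_union Xs p.+1 :\: prefix_union Xs p = nth set0 Xs p.
Proof.
move=> ps; have E phi : (phi \in prefix_union Xs p.+1) =
    (phi \in nth set0 Xs p) || (phi \in prefix_union Xs p).
  by rewrite !inE (take_nth set0 ps) has_rcons.
split; first by apply/subsetP => phi h; rewrite E h orbT.
apply/setP => phi; rewrite in_setD E; case: (boolP (phi \in prefix_union Xs p)) => /=.
  rewrite inE => /hasP[X /(nthP set0)[i]].
  rewrite size_take_min leq_min => /andP[ip is_]; rewrite nth_take // => <- pX.
  by apply/esym/negbTE/negP => /(sep_nth ip ps pX); rewrite subxx.
by rewrite orbF.
Qed.

End Seq.

(** Closure of [X] upwards inside [s] means that the removed faces form a subcomplex. *)
Definition relative_tile X s : Prop :=
  [/\ maxset (mem S) s, s \in X, X \subset powerset s &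
      forall phi psi, psi \in X -> psi \subset phi -> phi \subset s -> phi \in X].

Lemma relative_tile_facet X s : relative_tile X s -> relative_facet S set0 X.
Proof.
case=> ms sX Xs up; exists s, (powerset s :\: X); split => //.
- split; first exact: subsetDl.
  move=> phi psi; rewrite !inE => /andP[pX ps] pp; rewrite (subset_trans pp ps) andbT.
  by apply: contra pX => /up; apply.
- by rewrite inE sX.
- by rewrite setI0 sub0set.
- by rewrite setDDr setDv set0U (setIidPr Xs).
Qed.

Lemma faces_relative_tile t : wf_code t -> maxset (mem S) t.2 -> relative_tile (faces t) t.2.
Proof.
move=> w m; split; rewrite ?faces_top //.
  by apply/subsetP => phi; rewrite facesE powersetE => /and3P[].
move=> phi psi; rewrite !facesE => /and3P[h1 _ h3] pp ->.
by rewrite (subset_trans h1 pp) /=; apply: contra h3; apply: subset_trans.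
Qed.

Lemma powerset_relative_tile s : maxset (mem S) s -> relative_tile (powerset s) s.
Proof. by move=> m; split=> // [|phi psi _ _]; rewrite powersetE. Qed.

Lemma powerset_morse_tile s : s != set0 -> morse_tile (powerset s).
Proof.
rewrite -card_gt0 => s0; exists #|s|.-1, 0, s, set0; split.
  by split; rewrite ?sub0set ?cards0 ?prednK.
by left; rewrite /deprived big_set0 setD0.
Qed.

(** Codes miss the empty face. Given to the first tile, it makes it a closed simplex, still critical
    of index 0. The critical tiles in [cX] are listed in the order of [crits l], so that indices are
    read by position. *)
Lemma morse_shelling_shells (R : realType) l :
  S != [set set0] -> shells S (S :\ set0) l ->
  exists (P : {set simplices W}) (N : nat) (F : nat -> simplices W)
         (cX : seq (simplices W)),
  [/\ morse_shelling R S set0 P N F, uniq cX, size cX = size (crits l),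
      forall X, X \in cX -> X \in P /\ exists k, critical_tile k X &
      forall X k, X \in P -> critical_tile k X ->
        X \in cX /\ k = nth 0 (crits l) (index X cX)].
Proof.
move=> S1 sl; have : S :\ set0 != set0.
  by apply: contraNneq S1 => e; rewrite -(setD1K S0) e setU0.
case: l sl => [[_ _ c _]|[rm s1] ts sl].
  by case/set0Pn => phi; rewrite c.
move=> _; have e1 : (rm, s1) = (set0, set0, s1).
  apply: shells_head sl => phi psi; rewrite !in_setD1 => /andP[_ pS] pp ->.
  exact: closedS pS pp.
rewrite e1 in sl *.
have [/= /andP[w1 wl] /andP[/allP p1 pl] c /= /andP[m1 ml]] := sl.
have s10 : s1 != set0 by move: w1; rewrite /wf_code /= proper0 sub0set.
pose Xs := powerset s1 :: map (@faces W) ts.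
have f1 phi : (phi \in powerset s1) = (phi == set0) || (phi \in faces (set0, set0, s1)).
  rewrite powersetE facesE /= sub0set subset0 /=.
  by have [->|] := eqVneq phi set0; rewrite ?sub0set ?andbT.
have pw : pairwise (@sep W) Xs.
  rewrite /= pl andbT; apply/allP => Y YX; apply/sepP => phi psi; rewrite f1.
  case/predU1P => [->|pf] pY; last by have /sepP := p1 _ YX; apply.
  by move/mapP: YX pY => [t _ ->] /faces_neq0; rewrite subset0.
have cov phi : (phi \in S) = has (fun X => phi \in X) Xs.
  rewrite /= f1 has_map -orbA; have [->|p0] := eqVneq phi set0; first by rewrite S0.
  by have := c phi; rewrite in_setD1 p0.
have tileX X : X \in Xs -> morse_tile X /\ exists2 s, s != set0 & relative_tile X s.
  rewrite inE => /predU1P[->|/mapP[t tl ->]].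
    split; first exact: powerset_morse_tile.
    by exists s1; last exact: powerset_relative_tile.
  have wt := allP wl _ tl; split; first exact: faces_morse_tile.
  exists t.2; first exact: faces_neq0 (faces_top wt).
  by apply: faces_relative_tile => //; apply: (allP ml).
have uX : uniq Xs.
  apply: pairwise_sep_uniq pw; apply/allP => X /tileX[_ [s _ [_ sX _ _]]].
  by apply/set0Pn; exists s.
pose ct := [seq t <- ts | critical_code t].
pose cX := powerset s1 :: map (@faces W) ct.
have subX : subseq cX Xs.
  by rewrite /= eqxx; apply: map_subseq; apply: filter_subseq.
have crE : crits ((set0, set0, s1) :: ts) = 0 :: map (@code_index W) ct.
  by rewrite /crits /= /critical_code /= eqxx /= /code_index /= cards0.
have ucX : uniq cX := subseq_uniq subX uX.
exists [set X in Xs], (size Xs), (prefix_union Xs), cX; split => //.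
- split; [split| |split].
  + by move=> X; rewrite inE => /tileX[_ [s _]]; apply: relative_tile_facet.
  + rewrite setD0; apply: realization_partition.
    * by move=> X; rewrite inE => /tileX[_ [s s0 []]]; exists s.
    * by move=> X Y s; rewrite !in_set; apply: (sep_disjoint pw).
    * move=> s; rewrite cov; split; first by case/hasP => X XX sX; exists X; rewrite ?inE.
      by case=> X; rewrite inE => XX sX; apply/hasP; exists X.
  + by move=> X; rewrite inE => /tileX[].
  + by apply/setP => phi; rewrite !inE take0.
  + by apply/setP => phi; rewrite setD0 cov inE take_size.
  + move=> p _; exists (prefix_union Xs p); last by rewrite setD0.
    by split; [exact: prefix_sub | exact: prefix_closed].
  + move=> p ps; have [h1 h2] := prefixS pw ps; split=> //.
    by rewrite h2 inE mem_nth.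
- by rewrite crE /= !size_map.
- move=> X XcX; rewrite inE (mem_subseq subX XcX); split=> //.
  move: XcX; rewrite inE => /predU1P[->|/mapP[t]].
    by exists 0; apply: closed_critical.
  rewrite mem_filter => /andP[ct_ tl] ->; exists (code_index t).
  by apply: faces_critical => //; apply: (allP wl).
- move=> X k; rewrite inE crE in_cons => /predU1P[-> /critical_tile_closed ->|].
    by rewrite mem_head /= eqxx.
  move=> /mapP[t tl ->] kX; have wt := allP wl _ tl.
  have [ct_ kt] := critical_faces wt kX.
  have Xct : faces t \in map (@faces W) ct by rewrite map_f // mem_filter ct_.
  rewrite /cX in_cons Xct orbT; split=> //=; case: eqP => [e|_].
    by move: kX; rewrite -e => /critical_tile_closed ->.
  (* The code [u] found at this position might be another code of the same tile; [critical_faces]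
     shows that the indices agree. *)
  set i := index _ _; have ic : i < size ct by rewrite -(size_map (@faces W)) index_mem.
  rewrite /= (nth_map t) // kt; set u := nth t ct i.
  have : u \in ct by rewrite mem_nth.
  rewrite mem_filter => /andP[uc /(allP wl) wu]; have := faces_critical wu uc.
  have -> : faces u = faces t by rewrite -(nth_map t set0) // nth_index.
  by case/(critical_faces wt).
Qed.

End Assembly.

(** * The order given by a discrete Morse function *)

Section MorseOrder.
Import Order.TTheory GRing.Theory Num.Theory.
Local Open Scope set_scope.
Local Open Scope nat_scope.
Variables (R : realType) (T : finType) (K : simplices T) (f : {set T} -> R).
Hypotheses (closedK : face_closed K) (morse : discrete_morse K f).
Implicit Types (s t x y sigma tau : {set T}) (A : {set {set T}}).

Notation P := (K :\ set0).
Notation cofaces := (exceptional_cofaces K f).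
Notation subfaces := (exceptional_faces K f).

Lemma face_in s t : t \in P -> s \subset t -> s != set0 -> s \in P.
Proof. by rewrite !in_setD1 => /andP[_ tK] st ->; apply: closedK st. Qed.

Lemma cofacesE s t : s \in P ->
  (t \in cofaces s) = [&& t \in P, s \proper t & (f t <= f s)%R].
Proof.
rewrite in_setD1 => /andP[s0 _]; rewrite in_set in_setD1.
have [->|//] := eqVneq t set0.
by rewrite properE subset0 (negbTE s0) /= !andbF.
Qed.

Lemma subfacesE s t :
  (t \in subfaces s) = [&& t \in P, t \proper s & (f s <= f t)%R].
Proof. by rewrite in_set. Qed.

Lemma cofaces_subfaces s t : s \in P -> t \in P -> (t \in cofaces s) = (s \in subfaces t).
Proof. by move=> sP tP; rewrite cofacesE // subfacesE sP tP. Qed.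

Lemma cofaces_uniq s t t' : s \in P -> t \in cofaces s -> t' \in cofaces s -> t = t'.
Proof. by move=> /morse[/card_le1_eqP h _] ts t's; apply: (h _ _ t's ts). Qed.

Lemma subfaces_uniq s t t' : s \in P -> t \in subfaces s -> t' \in subfaces s -> t = t'.
Proof. by move=> /morse[_ /card_le1_eqP h] ts t's; apply: (h _ _ t's ts). Qed.

(** Suppose that [x |: s] lies strictly between [s] and [t]. Uniqueness of [t] gives
    [f s < f (x |: s)], hence [f t <= f (x |: s)], and [t] has two exceptional faces. *)
Lemma coface_card s t : s \in P -> t \in cofaces s -> #|t| = #|s|.+1.
Proof.
move=> sP ts; have := ts; rewrite cofacesE // => /and3P[tP st fts].
have /properP[_ [x xt xs]] := st.
have [e|xst] := eqVneq (x |: s) t; first by rewrite -e cardsU1 xs.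
have s_x : s \proper x |: s.
  by apply/properP; split; [exact: subsetUr | exists x; rewrite ?setU11].
have x_t : x |: s \proper t.
  by rewrite properEneq xst subUset sub1set xt proper_sub.
have xP : x |: s \in P.
  by apply: face_in tP (proper_sub x_t) _; apply/set0Pn; exists x; rewrite setU11.
have /lt_le_trans fx : (f s < f (x |: s))%R.
  rewrite ltNge; apply: contra xst => h; apply/eqP/(cofaces_uniq sP) => //.
  by rewrite cofacesE // xP s_x.
have s_t : s \in subfaces t by rewrite -cofaces_subfaces.
have : x |: s \in subfaces t.
  by rewrite subfacesE xP x_t (le_trans fts) // ltW // fx.
move=> /(subfaces_uniq tP s_t) e.
by move: s_x; rewrite -e properxx.
Qed.

(** Otherwise [s] and [t] are both exceptional cofaces of [u]. *)
Lemma coface_subface_excl s t u : s \in P -> t \in cofaces s -> u \in subfaces s -> False.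
Proof.
move=> sP ts us; have := us; rewrite subfacesE => /and3P[uP u_s fu].
have su : s \in cofaces u by rewrite cofaces_subfaces.
move: ts; rewrite cofacesE // => /and3P[tP st fts].
have tu : t \in cofaces u.
  by rewrite cofacesE // tP (proper_trans u_s st) (le_trans fts).
by move: st; rewrite (cofaces_uniq uP su tu) properxx.
Qed.

Definition upper s := if [pick t in cofaces s] is Some t then t else s.

(* On a gradient pair this is the value at the upper face, which is the smaller of
   the two. *)
Definition level s : R := f (upper s).

Lemma upper_id s : cofaces s = set0 -> upper s = s.
Proof. by rewrite /upper => e; case: pickP => // t; rewrite e inE. Qed.

Lemma upper_coface s t : s \in P -> t \in cofaces s -> upper s = t.
Proof.
move=> sP ts; rewrite /upper; case: pickP => [u us|/(_ t)]; last by rewrite /= ts.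
exact: cofaces_uniq us ts.
Qed.

(** Both levels are compared with [f s]. If [t] has an exceptional coface [u] with [f u <= f s],
    then [s] and [t] are two exceptional faces of [u]. *)
Lemma level_lt s t : s \in P -> t \in P -> s \proper t -> t \notin cofaces s ->
  (level s < level t)%R.
Proof.
move=> sP tP st tns; apply: (@le_lt_trans _ _ (f s)).
  rewrite /level /upper; case: pickP => [u|//]; rewrite cofacesE // => /and3P[_ _].
  by [].
rewrite /level /upper; case: pickP => [u ut|_]; rewrite ltNge; last first.
  by apply: contra tns => fts; rewrite cofacesE // tP st.
apply/negP => fus; move: (ut); rewrite cofacesE // => /and3P[uP tu _].
have us : u \in cofaces s by rewrite cofacesE // uP (proper_trans st tu).
rewrite cofaces_subfaces // in us; rewrite cofaces_subfaces // in ut.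
by move: st; rewrite (subfaces_uniq uP us ut) properxx.
Qed.

(* Within a gradient pair the upper face comes first. *)
Definition before s t : bool :=
  ((level s < level t) || ((level s == level t) && (#|t| <= #|s|)%N))%R.

Lemma before_total : total before.
Proof.
move=> s t; rewrite /before; case: (ltgtP (level s) (level t)) => //= _.
exact: leq_total.
Qed.

Lemma before_trans : transitive before.
Proof.
move=> t s u; rewrite /before => /orP[st|/andP[/eqP -> c]].
  case/orP => [tu|/andP[/eqP <- _]]; last by rewrite st.
  by rewrite (lt_trans st tu).
case/orP => [->//|/andP[/eqP -> c']]; by rewrite eqxx (leq_trans c' c) orbT.
Qed.

Lemma before_level s t : (level s < level t)%R -> before s t && ~~ before t s.
Proof.
by move=> h; rewrite /before h /= (lt_gtF h) /= negb_and (gt_eqF h).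
Qed.

(** The upper face has no exceptional coface, so the levels agree and cardinality decides. *)
Lemma before_pair s t : s \in P -> t \in cofaces s -> before t s && ~~ before s t.
Proof.
move=> sP ts; have := ts; rewrite cofacesE // => /and3P[tP st _].
have e : level s = level t.
  rewrite /level (upper_coface sP ts) upper_id //.
  apply/eqP; apply: contraT => /set0Pn[u ut].
  by case: (coface_subface_excl tP ut (u := s)); rewrite -cofaces_subfaces.
by rewrite /before e ltxx eqxx /= (ltnW (proper_card st)) -ltnNge proper_card.
Qed.

Lemma vertex_sd y : y \in P -> [set y] \in sd K.
Proof.
move=> yP; apply/sdP; split=> [s /set1P -> //|s t /set1P -> /set1P ->].
by rewrite /nested subxx.
Qed.

Lemma verts1 y x : y \in P -> (x \in verts (sd K) [set y]) =
  [&& x \in P, x != y & nested x y].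
Proof.
move=> yP; have yG := vertex_sd yP.
apply/idP/and3P => [h|[xP xy c]].
  have [xy _ xP c] := vertsP h; split=> //; first by rewrite inE in xy.
  by rewrite nested_sym c ?set11.
rewrite inE inE xy /=; apply: sd_setU1 => // t /set1P ->.
by rewrite nested_sym.
Qed.

Definition critical y : bool := (cofaces y == set0) && (subfaces y == set0).

(** By [level_lt], [A] contains the proper faces of [y] and none of its proper cofaces, except for
    the partner of [y] in a gradient pair. *)
Lemma handle_crits_morse A y : y \in P -> y \notin A -> A \subset P ->
  (forall x, x \in P -> x \in A -> before x y) ->
  (forall x, x \in P -> x \notin A -> before y x) ->
  handle_crits (sd K) [set y] A (if critical y then [:: #|y|.-1] else [::]).
Proof.
move=> yP yA AP Ab Aa.
have yG := vertex_sd yP.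
apply: handle_crits_verts; first exact: sd_closed.
  by rewrite disjoints_subset sub1set inE.
set A' := A :&: _.
have A'v : A' \subset verts (sd K) [set y] by exact: subsetIr.
have A'P x : (x \in A') = [&& x \in A, x != y & nested x y].
  rewrite in_setI verts1 //; case: (boolP (x \in A)) => //= xA.
  by rewrite (subsetP AP).
have above x : x \in P -> y \proper x -> x \notin cofaces y -> x \notin A.
  move=> xP yx xy; have /andP[_] := before_level (level_lt yP xP yx xy).
  by apply: contra; apply: Ab.
have below x : x \in P -> x \proper y -> y \notin cofaces x -> x \in A.
  move=> xP xy yx; have /andP[_] := before_level (level_lt xP yP xy yx).
  by apply: contraR => xA; apply: Aa.
have proper_cmp x : x != y -> nested x y -> (x \proper y) || (y \proper x).
  by move=> xy; rewrite !properEneq xy (eq_sym y) xy.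
have y0 : y != set0 by move: yP; rewrite in_setD1 => /andP[].
have cy : #|y| = #|y|.-1.+1 by rewrite prednK // card_gt0.
have in_below x : x \proper y -> x != y /\ nested x y.
  by move=> xy; rewrite proper_neq // /nested proper_sub.
have [/andP[/eqP cf0 /eqP sf0]|] := boolP (critical y).
  have -> : A' = boundary y.
    apply/setP => x; rewrite A'P inE; apply/and3P/andP => [[xA xy c]|[x0 xy]].
      have xP := subsetP AP _ xA; split; first by move: xP; rewrite in_setD1 => /andP[].
      have /orP[//|yx] := proper_cmp _ xy c.
      by have := above _ xP yx; rewrite cf0 inE xA => /(_ isT).
    have xP := face_in yP (proper_sub xy) x0.
    have [? ?] := in_below _ xy; split=> //; apply: below => //.
    by rewrite cofaces_subfaces // sf0 inE.
  apply: boundary_crits => //; apply/subsetP => x; rewrite inE => /andP[x0 xy].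
  have [? ?] := in_below _ xy; rewrite verts1 //; apply/and3P; split=> //.
  exact: face_in yP (proper_sub xy) x0.
rewrite negb_and => /orP[/set0Pn[tau ty]|/set0Pn[sigma sy]].
  (* [y] is the lower face of a pair: [tau] was added before it, and is comparable to all of
     [A']. *)
  apply: (@handle_crits_nbhd _ _ _ _ 0 [::]) => //.
  have := ty; rewrite cofacesE // => /and3P[tP yt _].
  apply: (cone_crits (tau := tau)) => //.
    rewrite A'P eq_sym (proper_neq yt) /nested (proper_sub yt) orbT !andbT.
    have /andP[_] := before_pair yP ty; apply: contraR => tA; exact: Aa.
  move=> x; rewrite A'P => /and3P[xA xy c]; have xP := subsetP AP _ xA.
  case/orP: (proper_cmp _ xy c) => [xy'|yx].
    by rewrite /nested (proper_sub (proper_trans xy' yt)).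
  have [xc|/(above _ xP yx)] := boolP (x \in cofaces y); last by rewrite xA.
  by rewrite (cofaces_uniq yP xc ty) /nested subxx.
(* [y] is the upper face of a pair: [sigma], a ridge by [coface_card], is the only proper face not
   yet added. *)
apply: (@handle_crits_nbhd _ _ _ _ 0 [::]) => //.
have := sy; rewrite subfacesE => /and3P[sP sy' _].
have ys : y \in cofaces sigma by rewrite cofaces_subfaces.
have [v vy es] : exists2 v, v \in y & sigma = y :\ v.
  apply: ridgesP; rewrite inE powersetE proper_sub //=.
  by rewrite (coface_card sP ys).
have nx x : x \in P -> x \in cofaces y -> False.
  by move=> xP xy; apply: coface_subface_excl xy sy.
have A'E : A' = punctured y v set0.
  apply/setP => x; rewrite A'P inE -es proper0; apply/and3P/and3P => [[xA xy c]|[x0 xy xs]].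
    have xP := subsetP AP _ xA; split.
    - by move: xP; rewrite in_setD1 => /andP[].
    - have /orP[//|yx] := proper_cmp _ xy c.
      have [/(nx _ xP) []|/(above _ xP yx)] := boolP (x \in cofaces y).
      by rewrite xA.
    - have /andP[_] := before_pair sP ys; apply: contraNneq => <-; exact: Ab.
  have xP := face_in yP (proper_sub xy) x0.
  have [? ?] := in_below _ xy; split=> //; apply: below => //.
  rewrite cofaces_subfaces //; apply: contra xs => xsf.
  by rewrite (subfaces_uniq yP xsf sy).
rewrite A'E in A'v *; apply: punctured_crits => //.
by rewrite -es proper0; move: sP; rewrite in_setD1 => /andP[].
Qed.

Lemma link_sd : link (sd K) set0 = sd (sd K).
Proof.
apply/setP => phi; apply/linkP/sdP.
  case=> /flagP[h1 h2] h3; split=> // c cp; rewrite in_setD1 h1 // andbT.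
  by rewrite -proper0 h3.
case=> h1 h2; split; last by move=> c /h1; rewrite in_setD1 proper0 => /andP[].
by apply/flagP; split=> // c /h1; rewrite in_setD1 => /andP[].
Qed.

(** With [g = set0] the link is the second subdivision itself, so it can be built by the handles of
    the vertices [[set y]]. *)
Lemma nbhd_sd : nbhd (sd K) set0 P = sd (sd K) :\ set0.
Proof.
rewrite -link_sd -nbhd_verts; last exact: sd_closed.
congr nbhd; apply/setP => x; rewrite [RHS]inE in_set0 setU0 /=.
apply/idP/idP => [/vertex_sd //|/sdP[/(_ x)]].
by rewrite set11 => /(_ isT).
Qed.

Lemma nbhd_crits_morse : exists cs,
  [/\ uniq cs, forall s, (s \in cs) = (s \in P) && critical s &
      nbhd_crits (sd K) set0 P [seq #|s : {set T}|.-1 | s <- cs]].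
Proof.
pose L := sort before (enum P).
have LP x : (x \in L) = (x \in P) by rewrite mem_sort mem_enum.
have uL : uniq L by rewrite sort_uniq enum_uniq.
have sL : pairwise before L.
  by rewrite -(sorted_pairwise before_trans); apply/sort_sorted/before_total.
(* Induction on the prefix [p] of simplices whose stars have been added; [cs] lists its critical
   faces in the same order as their tiles. *)
suff H p q : L = p ++ q -> exists cs,
    [/\ uniq cs, forall s, (s \in cs) = (s \in p) && critical s &
      nbhd_crits (sd K) set0 [set x in p] [seq #|s : {set T}|.-1 | s <- cs]].
  have [cs [ucs mcs ncs]] := H L [::] (esym (cats0 L)); exists cs; split=> //.
    by move=> s; rewrite mcs LP.
  suff -> : P = [set x in L] by [].
  by apply/setP => x; rewrite [RHS]inE LP.
elim/last_ind: p q => [|p y ih] q.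
  move=> _; exists [::]; split=> //.
  suff -> : [set x in [::]] = set0 :> {set {set T}} by apply: nbhd_crits0.
  by apply/setP => x; rewrite !inE.
rewrite cat_rcons => eL; have [cs [ucs mcs ncs]] := ih _ eL.
have yP : y \in P by rewrite -LP eL mem_cat mem_head orbT.
move: uL; rewrite eL cat_uniq => /and3P[up hp /= /andP[yq uq]].
have yp : y \notin p by apply: contra hp => yp; apply/hasP; exists y; rewrite ?mem_head.
exists (cs ++ if critical y then [:: y] else [::]); split.
- rewrite cat_uniq ucs; case: ifP => //= _; rewrite orbF andbT mcs.
  by rewrite (negbTE yp).
- move=> s; rewrite mem_cat mcs mem_rcons in_cons.
  case: ifP => cy; rewrite ?in_nil ?mem_seq1 ?orbF.
    by have [->|//] := eqVneq s y; rewrite ?cy ?orbT // orbF.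
  by have [->|//] := eqVneq s y; rewrite cy !andbF.
- have -> : [set x in rcons p y] = y |: [set x in p].
    by apply/setP => x; rewrite in_setU1 !inE mem_rcons in_cons.
  rewrite map_cat; apply: nbhd_critsU => //.
    rewrite inE in_set0 setU0 /=.
    exact: vertex_sd.
  rewrite setU0; have -> : [seq #|s : {set T}|.-1 | s <- if critical y then [:: y] else [::]] =
      if critical y then [:: #|y|.-1] else [::] by case: ifP.
  move: sL; rewrite eL pairwise_cat => /and3P[/allrelP pq _ /= /andP[/allP yq' _]].
  apply: handle_crits_morse => //.
  + by rewrite inE.
  + by apply/subsetP => x; rewrite inE -LP eL mem_cat => ->.
  + by move=> x _; rewrite inE => xp; apply: pq => //; apply: mem_head.
  (* Here [x] comes after [y] or is [y] itself, where totality gives reflexivity. *)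
  + move=> x; rewrite -LP eL mem_cat in_cons in_set => /orP[->//|/predU1P[-> _|/yq' //]].
    by have := before_total y y; rewrite orbb.
Qed.

Lemma critical_faceP s k :
  critical_face K f k s <-> [/\ s \in P, critical s & k = #|s|.-1].
Proof.
split=> [[sK cs c0 s0]|[sP /andP[/eqP c0 /eqP s0] ->]].
  by rewrite in_setD1 sK -card_gt0 cs /critical c0 s0 !eqxx.
by move: sP; rewrite in_setD1 -card_gt0 => /andP[s1 sK]; split=> //; rewrite prednK.
Qed.

End MorseOrder.

Theorem theorem1p1 (R : realType) (T : finType) (V : {set T})
    (K : simplices T) (f : {set T} -> R) :
  simplicial_complex V K -> discrete_morse K f ->
  exists (P : {set simplices {set {set T}}}) (N : nat)
         (F : nat -> simplices {set {set T}}),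
    morse_shelling R (sd (sd K)) set0 P N F /\
    exists phi : simplices {set {set T}} -> {set T},
      functions.set_bij (fun X => X \in P /\ exists k, critical_tile k X)
              (fun s => exists k, critical_face K f k s) phi /\
      (forall X k, X \in P -> critical_tile k X ->
         critical_face K f k (phi X)).
Proof.
move=> [V0 _ vK closedK] morse.
have [cs [ucs mcs [ts sts cts]]] := nbhd_crits_morse closedK morse.
rewrite link_sd nbhd_sd in sts.
have G0 : set0 \in sd (sd K) by apply/sdP; split=> [s|s t]; rewrite inE.
have [v vV] := set0Pn _ V0.
have G1 : sd (sd K) != [set set0].
  suff vG : [set [set [set v]]] \in sd (sd K).
    apply: contraTneq vG => ->; rewrite inE.
    by apply/set0Pn; exists [set [set v]]; rewrite set11.
  have ne (U : finType) (u : U) : [set u] != set0.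
    by apply/set0Pn; exists u; rewrite set11.
  do 2!(apply: vertex_sd; rewrite in_setD1 ne /=).
  exact: vK.
have [P [N [F [cX [sh ucX scX cXP Pc]]]]] :=
  morse_shelling_shells (@sd_closed _ _) G0 R G1 sts.
(* Tiles and faces are matched by position. The lists have equal length, so the default [set0] is
   never reached on a critical tile. *)
exists P, N, F; split=> //; exists (fun X => nth set0 cs (index X cX)).
have szE : size cX = size cs by rewrite scX cts size_map.
have face X k : X \in P -> critical_tile k X ->
    critical_face K f k (nth set0 cs (index X cX)).
  move=> XP /(Pc _ _ XP)[XcX ->]; have iX : index X cX < size cs by rewrite -szE index_mem.
  apply/critical_faceP; have := mem_nth set0 iX; rewrite mcs => /andP[? ?].
  by split=> //; rewrite cts (nth_map set0).
split=> //; split.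
- by move=> X [XP [k kX]]; exists k; apply: face.
- move=> X Y /classical_sets.set_mem [XP [k kX]] /classical_sets.set_mem [YP [j jY]] /eqP.
  have [XcX _] := Pc _ _ XP kX; have [YcX _] := Pc _ _ YP jY.
  rewrite nth_uniq -?szE ?index_mem // => /eqP e.
  by rewrite -(nth_index set0 XcX) e nth_index.
- move=> s [k /critical_faceP[sP sc _]].
  have scs : s \in cs by rewrite mcs sP.
  have is_ : index s cs < size cX by rewrite szE index_mem.
  exists (nth set0 cX (index s cs)); first exact/cXP/mem_nth.
  by rewrite index_uniq // nth_index.
Qed.
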